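(* Let $\Lambda$ be an Artin algebra and let $\mathcal X$ be a resolving subcategory of $\mathrm{mod}\,\Lambda$ of finite representation type. (i) $\mathrm{gl.dim}\,\mathsf A(\mathcal X)=0$ if and only if $\Lambda$ is semisimple (and then $\mathcal X=\mathrm{proj}\,\Lambda$). (ii) $\mathrm{gl.dim}\,\mathsf A(\mathcal X)=1$ if and only if $\mathrm{gl.dim}\,\Lambda=1$ and $\mathcal X=\mathrm{proj}\,\Lambda$. (iii) $\mathrm{gl.dim}\,\mathsf A(\mathcal X)=2$ if and only if either (a) $\mathcal X=\mathrm{proj}\,\Lambda$ and $\mathrm{gl.dim}\,\Lambda=2$, or (b) $\mathcal X\neq\mathrm{proj}\,\Lambda$ and $\mathrm{res.dim}_{\mathcal X}\,\mathrm{mod}\,\Lambda\le2$. (iv) If $\mathrm{res.dim}_{\mathcal X}\,\mathrm{mod}\,\Lambda\ge3$, then $\mathrm{gl.dim}\,\mathsf A(\mathcal X)=\mathrm{res.dim}_{\mathcal X}\,\mathrm{mod}\,\Lambda$. In any case, $\mathrm{gl.dim}\,\mathsf A(\mathcal X)=\mathrm{gl.dim}\,\Lambda$ if $\mathcal X=\mathrm{proj}\,\Lambda$, and $\mathrm{gl.dim}\,\mathsf A(\mathcal X)=\max\{2,\mathrm{res.dim}_{\mathcal X}\,\mathrm{mod}\,\Lambda\}$ if $\mathcal X\neq\mathrm{proj}\,\Lambda$.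
   Context: $\mathrm{mod}\,\Lambda$ is the category of finitely generated right $\Lambda$-modules and $\mathrm{proj}\,\Lambda$ its subcategory of projective modules. A full subcategory $\mathcal X\subseteq\mathrm{mod}\,\Lambda$ is resolving if it contains $\mathrm{proj}\,\Lambda$, is closed under extensions and kernels of epimorphisms, and (tacit convention) is closed under direct summands; it is of finite representation type if it has finitely many isomorphism classes of indecomposables, and then $\mathcal X=\mathrm{add}\,T$ for some $T$ (a representation generator), where $\mathrm{add}\,T$ is the category of direct summands of finite direct sums of copies of $T$. The Auslander algebra of $\mathcal X$ is the Artin algebra $\mathsf A(\mathcal X)=\mathrm{End}_\Lambda(T)^{\mathrm{op}}$ (well defined up to Morita equivalence). $\mathrm{res.dim}_{\mathcal X}A$ is the minimal $n$ such that there is an exact sequence $0\to X_n\to\cdots\to X_0\to A\to0$ with all $X_i\in\mathcal X$ ($\infty$ if none exists), and $\mathrm{res.dim}_{\mathcal X}\,\mathrm{mod}\,\Lambda=\sup\{\mathrm{res.dim}_{\mathcal X}A\mid A\in\mathrm{mod}\,\Lambda\}$. *)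

(* Defs.v *)
From HB Require Import structures.
From mathcomp Require Import all_boot all_algebra.
From mathcomp Require Import boolp.

Set Implicit Arguments.
Unset Strict Implicit.
Unset Printing Implicit Defensive.

Import GRing.Theory.
Local Open Scope ring_scope.

(** ** The extended natural numbers, [None] being infinity *)

Definition enat := option nat.

Definition enat_le (x y : enat) : Prop :=
  match x, y with
  | _, None => True
  | None, Some _ => False
  | Some m, Some n => (m <= n)%N
  end.

Definition enat_max (x y : enat) : enat :=
  match x, y with
  | Some m, Some n => Some (maxn m n)
  | _, _ => None
  end.

(* The least natural number satisfying [P], infinity if there is none. *)
Definition enat_inf (P : nat -> Prop) : enat :=
  if pselect (exists n, `[< P n >]) is left exP then Some (ex_minn exP)
  else None.

(* The supremum of a set of extended naturals, as its least upper bound. *)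
Definition enat_sup (S : enat -> Prop) : enat :=
  enat_inf (fun n => forall x, S x -> enat_le x (Some n)).

(** ** Modules

  [lmodType R] is the type of left [R]-modules; right [R]-modules are left
  modules over the converse ring [R^c]. *)

Notation rmodType R := (lmodType R^c).

Section Modules.
Variable R : pzRingType.
Implicit Types M N P : lmodType R.

Definition fin_gen M : Prop :=
  exists n (s : 'I_n -> M), forall x : M,
    exists c : 'I_n -> R, x = \sum_i c i *: s i.

Definition trivial_mod M : Prop := forall x : M, x = 0.

Definition surj M N (f : M -> N) : Prop := forall y, exists x, f x = y.

Definition mod_iso M N : Prop := exists f : {linear M -> N}, bijective f.

Definition exact M N P (f : {linear M -> N}) (g : {linear N -> P}) : Prop :=
  forall y, g y = 0 <-> exists x, f x = y.

Definition short_exact M N P (f : {linear M -> N}) (g : {linear N -> P}) :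
  Prop := [/\ injective f, exact f g & surj g].

Definition projective P : Prop :=
  forall M N (g : {linear M -> N}) (f : {linear P -> N}), surj g ->
    exists h : {linear P -> M}, forall x, g (h x) = f x.

Definition indecomposable M : Prop :=
  ~ trivial_mod M /\
  forall N P, mod_iso M (N * P)%type -> trivial_mod N \/ trivial_mod P.

Definition simple_mod M : Prop :=
  ~ trivial_mod M /\
  forall S : {pred M}, submod_closed S ->
    (forall x, x \in S -> x = 0) \/ (forall x, x \in S).

(* Finite direct sums of simple modules. *)
Inductive semisimple_mod : lmodType R -> Prop :=
| semisimple_mod0 M : trivial_mod M -> semisimple_mod M
| semisimple_modD M S N : simple_mod S -> semisimple_mod N ->
    mod_iso M (S * N)%type -> semisimple_mod M.

Definition direct_summand N M : Prop := exists P, mod_iso M (N * P)%type.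

(** *** Full subcategories of modules, as predicates on modules *)

Definition subcat := lmodType R -> Prop.

Definition subcat_eq (X Y : subcat) : Prop := forall M, X M <-> Y M.

(* Finitely generated projective modules. *)
Definition proj_cat : subcat := fun M => fin_gen M /\ projective M.

(* Direct summands of finite direct sums of copies of [T]. *)
Definition add_cat (T : lmodType R) : subcat := fun M =>
  exists n, direct_summand M {ffun 'I_n -> T}.

(* [X] is a resolving subcategory of the category of finitely generated
   modules. Closure under isomorphisms is contained in closure under direct
   summands. *)
Record resolving (X : subcat) : Prop := Resolving {
  resolving_fin_gen : forall M, X M -> fin_gen M;
  resolving_proj : forall M, proj_cat M -> X M;
  resolving_ext : forall M N P (f : {linear M -> N}) (g : {linear N -> P}),
    fin_gen N -> short_exact f g -> X M -> X P -> X N;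
  resolving_ker : forall M N P (f : {linear M -> N}) (g : {linear N -> P}),
    fin_gen M -> short_exact f g -> X N -> X P -> X M;
  resolving_summand : forall M N, direct_summand N M -> X M -> X N
}.

(* Finitely many isomorphism classes of indecomposables. *)
Definition fin_rep_type (X : subcat) : Prop :=
  exists n (I : 'I_n -> lmodType R), forall M,
    X M -> indecomposable M -> exists i, mod_iso M (I i).

(** *** Resolution dimension *)

(* There is an exact sequence 0 -> C n -> ... -> C 0 -> A -> 0 with all its
   [C i] in [X]; it is indexed by all of [nat], with [C i = 0] for [i > n]. *)
Definition has_resolution (X : subcat) (A : lmodType R) (n : nat) : Prop :=
  exists (C : nat -> lmodType R) (d : forall i, {linear C i.+1 -> C i})
         (e : {linear C 0 -> A}),
    [/\ forall i, (i <= n)%N -> X (C i),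
        forall i, (n < i)%N -> trivial_mod (C i),
        forall i, exact (d i.+1) (d i),
        exact (d 0) e
      & surj e].

Definition resdim (X : subcat) (A : lmodType R) : enat :=
  enat_inf (has_resolution X A).

(* The supremum over all finitely generated modules. *)
Definition resdim_mod (X : subcat) : enat :=
  enat_sup (fun x => exists2 A, fin_gen A & x = resdim X A).

End Modules.

Definition projdim (R : pzRingType) (M : lmodType R) : enat :=
  resdim (@proj_cat R) M.

(* The global dimension, computed in the category of finitely generated right
   modules, as usual for Artin algebras. *)
Definition gldim (R : pzRingType) : enat :=
  enat_sup (fun x => exists2 M : rmodType R, fin_gen M & x = projdim M).

Definition semisimple_ring (R : pzRingType) : Prop :=
  semisimple_mod ((R^c)^o : rmodType R).

(** ** Artin algebras *)

(* Descending chain condition on ideals. *)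
Definition artinian (k : comPzRingType) : Prop :=
  forall I : nat -> {pred k^o},
    (forall n, submod_closed (I n)) ->
    (forall n, {subset I n.+1 <= I n}) ->
    exists N, forall n, (N <= n)%N -> I n =i I N.

Definition artin_algebra (k : comNzRingType) (L : algType k) : Prop :=
  artinian k /\ fin_gen (L : lmodType k).

(** ** Endomorphism rings *)

Section Endo.
Variables (R : pzRingType) (T : lmodType R).

Definition endo := {linear T -> T}.

HB.instance Definition _ := gen_eqMixin endo.
HB.instance Definition _ := gen_choiceMixin endo.

Lemma endoP (f g : endo) : f =1 g -> f = g.
Proof.
case: f g => [f [[[f1 f2]] [fs]]] [g [[[g1 g2]] [gs]]] /= /funext fg; subst g.
by congr GRing.Linear.Pack; congr GRing.Linear.Class; congr (_ _);
  exact: Prop_irrelevance.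
Qed.

Definition endo_add (f g : endo) : endo := f \+ g.
Definition endo_opp (f : endo) : endo := \- f.
Definition endo_zero : endo := \0.
Definition endo_one : endo := idfun.
Definition endo_mul (f g : endo) : endo := f \o g.

Fact endo_addA : associative endo_add.
Proof. by move=> f g h; apply: endoP => x /=; rewrite addrA. Qed.
Fact endo_addC : commutative endo_add.
Proof. by move=> f g; apply: endoP => x /=; rewrite addrC. Qed.
Fact endo_add0 : left_id endo_zero endo_add.
Proof. by move=> f; apply: endoP => x /=; rewrite add0r. Qed.
Fact endo_addN : left_inverse endo_zero endo_opp endo_add.
Proof. by move=> f; apply: endoP => x /=; rewrite addNr. Qed.

HB.instance Definition _ := GRing.isZmodule.Build endo
  endo_addA endo_addC endo_add0 endo_addN.

Fact endo_mulA : associative endo_mul.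
Proof. by move=> f g h; apply: endoP. Qed.
Fact endo_mul1 : left_id endo_one endo_mul.
Proof. by move=> f; apply: endoP. Qed.
Fact endo_1mul : right_id endo_one endo_mul.
Proof. by move=> f; apply: endoP. Qed.
Fact endo_mulDl : left_distributive endo_mul +%R.
Proof. by move=> f g h; apply: endoP. Qed.
Fact endo_mulDr : right_distributive endo_mul +%R.
Proof. by move=> f g h; apply: endoP => x /=; rewrite raddfD. Qed.

HB.instance Definition _ := GRing.Zmodule_isPzRing.Build endo
  endo_mulA endo_mul1 endo_1mul endo_mulDl endo_mulDr.

Lemma endo_mulE (f g : endo) x : (f * g) x = f (g x).
Proof. by []. Qed.

End Endo.

(* The opposite of the endomorphism ring, for a representation generator [T]
   of a subcategory. *)
Definition auslander_algebra (R : pzRingType) (T : lmodType R) : pzRingType :=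
  (endo T)^c.

(* Main.v *)
From HB Require Import structures.
Require Import Defs.
From mathcomp Require Import all_boot all_algebra.
From mathcomp Require Import boolp classical_sets.

(* Write S for the endomorphism ring of T.  Right modules over A are left
   modules over S, whose finitely generated projectives are dual to X through
   Hom(-, T), whereas X-resolutions over L concern Hom(T, -): the theorem contains
   the left-right symmetry of the global dimension.  Both dimensions are
   therefore expressed by von Neumann regularity of maps in X.  If every map in
   degree n of every Hom(X, -)-exact complex in X is regular, the n-th syzygies of
   all modules split off and lie in X, so modules have X-resolutions of length
   n.  Conversely, let y be the map in degree n of a Hom(-, X)-exact complex
   Y and K its kernel.  For n >= 2, K has X-dimension at most n - 2, so by
   dimension shifting Hom(Y, K) is exact in degree n - 1, and this
   produces b with y b y = y; if X = proj, lower n are allowed because images or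
   cokernels split off.  The duality Hom(-, T) exchanges the two kinds of
   complexes over L and over S and preserves regularity, and the two
   implications combine to compare the dimensions in both directions.  Finally,
   gl.dim A <= 1 makes all maps in degree 1 of such complexes regular, so the
   epimorphisms from projectives onto objects of X split and X = proj. *)

Set Implicit Arguments.
Unset Strict Implicit.
Unset Printing Implicit Defensive.
Import GRing.Theory.
Local Open Scope ring_scope.

(** * Submodules, quotients and short exact sequences *)

Section Linear.
Variable R : pzRingType.
Implicit Types M N P Q K : lmodType R.

Definition mklin M N (f : M -> N) (hf : linear f) : {linear M -> N} :=
  HB.pack f (GRing.isLinear.Build R M N *:%R f hf).

Lemma linear_inj M N (f : {linear M -> N}) :
  (forall x, f x = 0 -> x = 0) -> injective f.
Proof.
move=> f0 x y fxy; apply/eqP; rewrite -subr_eq0; apply/eqP/f0.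
by rewrite linearB fxy subrr.
Qed.

Lemma linear_bij M N (f : {linear M -> N}) :
  injective f -> surj f -> bijective f.
Proof.
move=> fi fs; have [g gK] := choice fs.
by exists g => // x; apply: fi; rewrite gK.
Qed.

Lemma linear_lift K M N (i : {linear K -> M}) (f : N -> M) :
  injective i -> linear f -> (forall y, exists x, i x = f y) ->
  exists g : {linear N -> K}, forall y, i (g y) = f y.
Proof.
move=> ii fl h; have [g gE] := choice h.
have gl : linear g.
  by move=> a x y; apply: ii; rewrite linearP !gE fl.
by exists (mklin gl).
Qed.

Lemma linear_factor M N Q (p : {linear M -> Q}) (f : {linear M -> N}) :
  surj p -> (forall x, p x = 0 -> f x = 0) ->
  exists g : {linear Q -> N}, forall x, g (p x) = f x.
Proof.
move=> ps pf; have [s sK] := choice ps.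
have key x y : p x = p y -> f x = f y.
  move=> e; apply/eqP; rewrite -subr_eq0 -linearB; apply/eqP/pf.
  by rewrite linearB e subrr.
have gl : linear (f \o s).
  by move=> a x y /=; rewrite -linearP; apply: key; rewrite linearP !sK.
by exists (mklin gl) => x; apply: key; rewrite sK.
Qed.

Lemma linear_inv M N (f : {linear M -> N}) : bijective f ->
  exists g : {linear N -> M}, cancel f g /\ cancel g f.
Proof.
case=> g fK gK.
have gl : linear g by move=> a x y; apply: (can_inj fK); rewrite linearP !gK.
by exists (mklin gl).
Qed.

Record submod M := Submod {
  sm_pred :> {pred M};
  sm_closed : submod_closed sm_pred
}.

HB.instance Definition _ M (U : submod M) :=
  GRing.isSubmodClosed.Build R M (sm_pred U) (sm_closed U).

Definition smtype M (U : submod M) := {x : M | x \in sm_pred U}.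

HB.instance Definition _ M (U : submod M) := SubChoice.on (smtype U).
HB.instance Definition _ M (U : submod M) :=
  [SubChoice_isSubLmodule of smtype U by <:].

(* Locked, so that simplification does not expose the subtype. *)
Definition smval M (U : submod M) : {linear smtype U -> M} :=
  locked (val : {linear smtype U -> M}).

Lemma smval_inj M (U : submod M) : injective (smval U).
Proof. by rewrite /smval; unlock; exact: val_inj. Qed.

Lemma smvalP M (U : submod M) (u : smtype U) : smval U u \in U.
Proof. by rewrite /smval; unlock; exact: valP. Qed.

Lemma smval_surj M (U : submod M) x : x \in U -> exists u, smval U u = x.
Proof. by move=> xU; exists (exist _ x xU); rewrite /smval; unlock. Qed.

Fact prop_submod_closed M (P : M -> Prop) :
  P 0 -> (forall x y, P x -> P y -> P (x + y)) ->
  (forall a x, P x -> P (a *: x)) -> submod_closed (fun x => `[< P x >]).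
Proof.
move=> P0 PD PZ; split; first exact/asboolP.
by move=> a x y /asboolP Px /asboolP Py; apply/asboolP/PD => //; apply: PZ.
Qed.

Definition prop_submod M (P : M -> Prop) h0 hD hZ : submod M :=
  Submod (@prop_submod_closed M P h0 hD hZ).

Lemma prop_submodE M (P : M -> Prop) h0 hD hZ x :
  x \in @prop_submod M P h0 hD hZ <-> P x.
Proof. by rewrite /prop_submod /in_mem /=; split=> /asboolP. Qed.

Lemma ex_submod M (P : M -> Prop) :
  P 0 -> (forall x y, P x -> P y -> P (x + y)) ->
  (forall a x, P x -> P (a *: x)) -> exists U : submod M, forall x, x \in U <-> P x.
Proof.
by move=> h0 hD hZ; exists (prop_submod h0 hD hZ) => x; exact: prop_submodE.
Qed.

Section KerIm.
Variables (M N : lmodType R) (f : {linear M -> N}).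

Definition ker_submod : submod M.
Proof.
apply: (@prop_submod M (fun x => f x = 0)); first exact: linear0.
- by move=> x y fx fy; rewrite linearD fx fy addr0.
- by move=> a x fx; rewrite linearZ_LR fx scaler0.
Defined.

Definition im_submod : submod N.
Proof.
apply: (@prop_submod N (fun y => exists x, f x = y)).
- by exists 0; rewrite linear0.
- by move=> _ _ [x <-] [y <-]; exists (x + y); rewrite linearD.
- by move=> a _ [x <-]; exists (a *: x); rewrite linearZ_LR.
Defined.

Lemma ker_submodE x : x \in ker_submod <-> f x = 0.
Proof. exact: prop_submodE. Qed.

Lemma im_submodE y : y \in im_submod <-> exists x, f x = y.
Proof. exact: prop_submodE. Qed.

Definition kerm : lmodType R := smtype ker_submod.
Definition kerv : {linear kerm -> M} := smval ker_submod.

Lemma kervK x : f (kerv x) = 0.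
Proof. exact/ker_submodE/smvalP. Qed.

Lemma kerv_surj x : f x = 0 -> exists u, kerv u = x.
Proof. by move/ker_submodE/smval_surj. Qed.

Lemma kerv_inj : injective kerv.
Proof. exact: smval_inj. Qed.

Lemma kerv_lift P (g : {linear P -> M}) : (forall z, f (g z) = 0) ->
  exists u : {linear P -> kerm}, forall z, kerv (u z) = g z.
Proof.
by move=> fg; apply: linear_lift (@smval_inj _ _) (linearP g) _ => z; apply: kerv_surj.
Qed.

Lemma ker_short_exact : surj f -> short_exact kerv f.
Proof.
move=> fs; split=> //; first exact: kerv_inj.
by move=> y; split=> [|[x <-]]; [exact: kerv_surj | exact: kervK].
Qed.

Definition imm : lmodType R := smtype im_submod.
Definition imv : {linear imm -> N} := smval im_submod.

Lemma im_factor :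
  exists g : {linear M -> imm}, surj g /\ forall x, imv (g x) = f x.
Proof.
have fim x : exists u, imv u = f x by apply/smval_surj/im_submodE; exists x.
have [g gE] := linear_lift (@smval_inj _ _) (linearP f) fim.
exists g; split=> // y; have /im_submodE[x xE] := smvalP y.
by exists x; apply: (@smval_inj _ im_submod); rewrite -xE -gE.
Qed.

End KerIm.

(* The quotient is represented by canonically chosen elements of the cosets. *)
Section Quotient.
Variables (M : lmodType R) (U : submod M).

Definition coset_repr (x : M) : M := choose (fun y => y - x \in U) x.

Fact coset_reprP x : coset_repr x - x \in U.
Proof.
by apply: (@chooseP _ (fun y => y - x \in U)); rewrite subrr rpred0.
Qed.

(** Equal cosets define the same predicate, and [choose] forgets its default argument once that
    argument satisfies the predicate. *)
Fact coset_repr_eq x y : x - y \in U -> coset_repr x = coset_repr y.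
Proof.
move=> xy; rewrite /coset_repr.
have e : (fun z => z - x \in U) =1 (fun z => z - y \in U).
  by move=> z /=; rewrite -[z - y](subrKA x) (rpredDr _ xy).
rewrite (eq_choose e); apply: choose_id => //=.
by rewrite subrr rpred0.
Qed.

Definition quot_mod := {x : M | coset_repr x == x}.
HB.instance Definition _ := SubChoice.on quot_mod.

Fact coset_reprK x : coset_repr (coset_repr x) == coset_repr x.
Proof. exact/eqP/coset_repr_eq/coset_reprP. Qed.

Definition quot_pi (x : M) : quot_mod := exist _ (coset_repr x) (coset_reprK x).

Fact quot_piK (q : quot_mod) : quot_pi (val q) = q.
Proof. by apply: val_inj => /=; apply/eqP; case: q. Qed.

Fact quot_pi_eq x y : quot_pi x = quot_pi y <-> x - y \in U.
Proof.
split=> [[e]|xy]; last by apply: val_inj; exact: coset_repr_eq.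
have := coset_reprP y; rewrite -e => ry.
by rewrite -(subrKA (coset_repr x)) rpredD// -opprB rpredN coset_reprP.
Qed.

Fact quot_ind (P : quot_mod -> Prop) : (forall x, P (quot_pi x)) -> forall q, P q.
Proof. by move=> h q; rewrite -[q]quot_piK. Qed.

Definition quot_add (q1 q2 : quot_mod) := quot_pi (val q1 + val q2).
Definition quot_opp (q : quot_mod) := quot_pi (- val q).
Definition quot_zero := quot_pi 0.
Definition quot_scale a (q : quot_mod) := quot_pi (a *: val q).

Fact quot_addE x y : quot_add (quot_pi x) (quot_pi y) = quot_pi (x + y).
Proof. by apply/quot_pi_eq; rewrite opprD addrACA rpredD ?coset_reprP. Qed.

Fact quot_oppE x : quot_opp (quot_pi x) = quot_pi (- x).
Proof. by apply/quot_pi_eq; rewrite -opprD rpredN coset_reprP. Qed.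

Fact quot_scaleE a x : quot_scale a (quot_pi x) = quot_pi (a *: x).
Proof. by apply/quot_pi_eq; rewrite -scalerBr rpredZ ?coset_reprP. Qed.

Fact quot_addA : associative quot_add.
Proof.
elim/quot_ind=> x; elim/quot_ind=> y; elim/quot_ind=> z.
by rewrite !quot_addE addrA.
Qed.
Fact quot_addC : commutative quot_add.
Proof. by elim/quot_ind=> x; elim/quot_ind=> y; rewrite !quot_addE addrC. Qed.
Fact quot_add0 : left_id quot_zero quot_add.
Proof. by elim/quot_ind=> x; rewrite quot_addE add0r. Qed.
Fact quot_addN : left_inverse quot_zero quot_opp quot_add.
Proof. by elim/quot_ind=> x; rewrite quot_oppE quot_addE addNr. Qed.

HB.instance Definition _ := GRing.isZmodule.Build quot_mod
  quot_addA quot_addC quot_add0 quot_addN.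

Fact quot_scaleA a b q : quot_scale a (quot_scale b q) = quot_scale (a * b) q.
Proof. by elim/quot_ind: q => x; rewrite !quot_scaleE scalerA. Qed.
Fact quot_scale1 : left_id 1 quot_scale.
Proof. by move=> q; elim/quot_ind: q => x; rewrite quot_scaleE scale1r. Qed.
Fact quot_scaleDr : right_distributive quot_scale +%R.
Proof.
move=> a q r; elim/quot_ind: q => x; elim/quot_ind: r => y.
rewrite -[quot_pi x + _]/(quot_add _ _) quot_addE !quot_scaleE scalerDr.
by rewrite -quot_addE.
Qed.
Fact quot_scaleDl q : {morph quot_scale^~ q : a b / a + b}.
Proof.
move=> a b; elim/quot_ind: q => x.
by rewrite !quot_scaleE scalerDl -quot_addE.
Qed.

HB.instance Definition _ := GRing.Zmodule_isLmodule.Build R quot_mod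
  quot_scaleA quot_scale1 quot_scaleDr quot_scaleDl.

Fact quot_pi_linear : linear quot_pi.
Proof. by move=> a x y; rewrite -quot_addE -quot_scaleE. Qed.

Definition quotp : {linear M -> quot_mod} := mklin quot_pi_linear.

Lemma quotp_surj : surj quotp.
Proof. by move=> q; exists (val q); exact: quot_piK. Qed.

Lemma quotp_eq0 x : quotp x = 0 <-> x \in U.
Proof. by rewrite -{2}[x]subr0; exact: quot_pi_eq. Qed.

End Quotient.

End Linear.

(** * Finitely generated and projective modules *)

Section FinGen.
Variable R : pzRingType.
Implicit Types M N P Q K : lmodType R.

Definition free_mod (n : nat) : lmodType R := {ffun 'I_n -> R^o}.

Definition lincomb M n (s : 'I_n -> M) (c : 'I_n -> R) : M := \sum_i c i *: s i.

Fact free_map_linear M n (s : 'I_n -> M) :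
  linear (fun c : free_mod n => lincomb s c).
Proof.
move=> a c d; rewrite /lincomb scaler_sumr -big_split; apply: eq_bigr => i _.
by rewrite !ffunE scalerDl scalerA.
Qed.

Definition free_map M n (s : 'I_n -> M) : {linear free_mod n -> M} :=
  mklin (free_map_linear s).

Definition free_basis n (i : 'I_n) : free_mod n := [ffun j => (i == j)%:R].

Lemma free_decomp n (c : free_mod n) : c = lincomb (@free_basis n) c.
Proof.
apply/ffunP => j; rewrite /lincomb sum_ffunE (bigD1 j)//= big1 => [|i ij].
  by rewrite !ffunE eqxx addr0 -[_ *: _]/(c j * 1) mulr1.
by rewrite !ffunE (negbTE ij) scaler0.
Qed.

Lemma linear_lincomb M N (f : {linear M -> N}) n (s : 'I_n -> M) c :
  f (lincomb s c) = lincomb (f \o s) c.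
Proof. by rewrite linear_sum; apply: eq_bigr => i _; rewrite linearZ_LR. Qed.

Lemma free_fin_gen n : fin_gen (free_mod n).
Proof. by exists n, (@free_basis n) => c; exists c; exact: free_decomp. Qed.

Lemma free_projective n : projective (free_mod n).
Proof.
move=> M N g f gs; have [s sE] := choice (fun i => gs (f (free_basis i))).
exists (free_map s) => c; rewrite [in RHS](free_decomp c) !linear_lincomb.
by apply: eq_bigr => i _ /=; rewrite sE.
Qed.

Lemma fin_gen_free M : fin_gen M -> exists n (p : {linear free_mod n -> M}), surj p.
Proof.
case=> n [s sE]; exists n, (free_map s) => x; have [c ->] := sE x.
exists [ffun i => c i]; apply: eq_bigr => i _; by rewrite ffunE.
Qed.

Lemma fin_gen_surj M N (f : {linear M -> N}) :
  surj f -> fin_gen M -> fin_gen N.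
Proof.
move=> fs [n [s sE]]; exists n, (f \o s) => y; have [x <-] := fs y.
by have [c ->] := sE x; exists c; rewrite linear_lincomb.
Qed.

(** The cover [p] of [M] and a lift [h] of the cover [q] of [P] along [g] combine to a surjection
    from a product of two free modules onto [N]. *)
Lemma fin_gen_ext M N P (f : {linear M -> N}) (g : {linear N -> P}) :
  short_exact f g -> fin_gen M -> fin_gen P -> fin_gen N.
Proof.
case=> fi fg gs /fin_gen_free[m [p ps]] /fin_gen_free[n [q qs]].
have [h hE] := free_projective q gs.
have kl : linear (fun c : free_mod m * free_mod n => f (p c.1) + h c.2).
  by move=> a c d /=; rewrite !linearP /= scalerDr addrACA.
suff ks : surj (mklin kl).
  apply: fin_gen_surj ks _.
  have [a [s sE]] := free_fin_gen m; have [b [t tE]] := free_fin_gen n.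
  pose u (i : 'I_(a + b)) := match split i with
    inl i => (s i, 0) | inr j => (0, t j) end : free_mod m * free_mod n.
  exists (a + b)%N, u => -[x y]; have [c ->] := sE x; have [d ->] := tE y.
  exists (fun i => match split i with inl i => c i | inr j => d j end).
  rewrite big_split_ord /= -[LHS]/(_, _).
  under [X in _ = X + _]eq_bigr => i _ do rewrite /u (unsplitK (inl i)).
  under [X in _ = _ + X]eq_bigr => i _ do rewrite /u (unsplitK (inr i)).
  have e1 : \sum_i c i *: ((s i, 0) : free_mod m * free_mod n) = (\sum_i c i *: s i, 0).
    by elim/big_rec2: _ => // i x1 y1 _ ->; congr pair; rewrite /= scaler0 addr0.
  have e2 : \sum_i d i *: ((0, t i) : free_mod m * free_mod n) = (0, \sum_i d i *: t i).
    by elim/big_rec2: _ => // i x1 y1 _ ->; congr pair; rewrite /= scaler0 addr0.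
  by rewrite e1 e2; congr pair; rewrite /= ?addr0 ?add0r.
move=> y; have [c cE] := qs (g y).
have /fg[x xE] : g (y - h c) = 0 by rewrite linearB hE cE subrr.
have [d dE] := ps x; exists (d, c) => /=.
by rewrite dE xE subrK.
Qed.

Lemma projective_split M P (f : {linear M -> P}) :
  projective P -> surj f -> exists s : {linear P -> M}, cancel s f.
Proof. by move=> Pp fs; have [s sE] := Pp _ _ f idfun fs; exists s. Qed.

(** The complement is the kernel of [r], with projection [x - s (r x)]. *)
Lemma retract_direct_summand M N (s : {linear M -> N}) (r : {linear N -> M}) :
  cancel s r -> direct_summand M N.
Proof.
move=> sK; exists (kerm r).
have kl : linear (fun x => x - s (r x)).
  by move=> a x y; rewrite !linearP /= scalerDr addrACA.
have [|k kE] := linear_lift (@smval_inj _ _ (ker_submod r)) kl.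
  by move=> x; apply: kerv_surj; rewrite linearB sK subrr.
have fl : linear (fun x => (r x, k x)).
  by move=> a x y; rewrite !linearP.
exists (mklin fl); apply: linear_bij.
  apply: linear_inj => x [rx kx].
  by move: (kE x); rewrite kx rx !linear0 addr0 => <-.
move=> [y z]; exists (s y + kerv r z).
congr pair; first by rewrite linearD sK kervK addr0.
apply: (@kerv_inj _ _ _ r).
by rewrite kE [r _]linearD sK kervK addr0 addrC addKr.
Qed.

Lemma direct_summand_retract M N : direct_summand M N ->
  exists (s : {linear M -> N}) (r : {linear N -> M}), cancel s r.
Proof.
case=> P [f /linear_inv[g [fK gK]]].
have il : linear (fun x : M => (x, 0) : M * P).
  by move=> a x y; congr pair; rewrite /= scaler0 addr0.
have rl : linear (fun z : M * P => z.1) by [].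
exists (g \o mklin il), (mklin rl \o f) => x /=.
by rewrite gK.
Qed.

Lemma projective_retract M N (s : {linear M -> N}) (r : {linear N -> M}) :
  cancel s r -> projective N -> projective M.
Proof.
move=> sK Np A B g f gs; have [h hE] := Np _ _ g (f \o r) gs.
by exists (h \o s) => x /=; rewrite hE /= sK.
Qed.

Lemma fin_gen_retract M N (s : {linear M -> N}) (r : {linear N -> M}) :
  cancel s r -> fin_gen N -> fin_gen M.
Proof. by move=> sK; apply: (@fin_gen_surj _ _ r) => x; exists (s x). Qed.

Lemma proj_cat_free n : proj_cat (free_mod n).
Proof. by split; [exact: free_fin_gen | exact: free_projective]. Qed.

(** Subtracting [s (g y)] moves [y] into the kernel of [g], hence into the image of [f]; this
    defines the retraction [r]. *)
Lemma short_exact_split M N P (f : {linear M -> N}) (g : {linear N -> P}) :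
  short_exact f g -> projective P ->
  exists (r : {linear N -> M}) (s : {linear P -> N}),
    [/\ cancel f r, cancel s g & forall y, y = f (r y) + s (g y)].
Proof.
case=> fi fg gs Pp; have [s sK] := projective_split Pp gs.
have kl : linear (fun y => y - s (g y)).
  by move=> a x y; rewrite !linearP /= scalerDr addrACA.
have [|r rE] := linear_lift fi kl.
  by move=> y; apply/fg; rewrite linearB sK subrr.
exists r, s; split=> // y; last by rewrite rE subrK.
have gf0 : g (f y) = 0 by apply/fg; exists y.
by apply: fi; rewrite rE gf0 linear0 subr0.
Qed.

Lemma projective_ext M N P (f : {linear M -> N}) (g : {linear N -> P}) :
  short_exact f g -> projective M -> projective P -> projective N.
Proof.
move=> fgE Mp Pp A B u v us.
have [r [s [fK sK e]]] := short_exact_split fgE Pp.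
have [h hE] := Mp _ _ u (v \o f) us; have [k kE] := Pp _ _ u (v \o s) us.
exists ((h \o r) \+ (k \o g)) => y /=.
by rewrite linearD hE kE /= -linearD -e.
Qed.

Lemma proj_cat_resolving : resolving (@proj_cat R).
Proof.
split.
- by move=> M [].
- by [].
- move=> M N P f g _ fg [Mf Mp] [Pf Pp].
  by split; [exact: fin_gen_ext fg Mf Pf | exact: projective_ext fg Mp Pp].
- move=> M N P f g _ fg [Nf Np] [_ Pp].
  have [r [s [fK _ _]]] := short_exact_split fg Pp.
  by split; [exact: fin_gen_retract fK Nf | exact: projective_retract fK Np].
- move=> M N /direct_summand_retract[s [r sK]] [Nf Np].
  by split; [exact: fin_gen_retract sK Nf | exact: projective_retract sK Np].
Qed.

End FinGen.

(** * Dimension with respect to a resolving subcategory *)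

(** Left Noetherian rings; submodules are given by injective maps, so that isomorphic copies are
    covered at once. *)
Definition noeth (R : pzRingType) : Prop :=
  forall (M N : lmodType R) (i : {linear N -> M}),
    injective i -> fin_gen M -> fin_gen N.

Section PairMaps.
Variable R : pzRingType.
Variables M N : lmodType R.

Fact pair_inl_linear : linear (fun x : M => (x, 0) : M * N).
Proof. by move=> a x y; congr pair; rewrite /= scaler0 addr0. Qed.
Fact pair_inr_linear : linear (fun y : N => (0, y) : M * N).
Proof. by move=> a x y; congr pair; rewrite /= scaler0 addr0. Qed.
Fact pair_fst_linear : linear (fun z : M * N => z.1).
Proof. by []. Qed.
Fact pair_snd_linear : linear (fun z : M * N => z.2).
Proof. by []. Qed.

Definition pair_inl : {linear M -> (M * N)%type} := mklin pair_inl_linear.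
Definition pair_inr : {linear N -> (M * N)%type} := mklin pair_inr_linear.
Definition pair_fst : {linear (M * N)%type -> M} := mklin pair_fst_linear.
Definition pair_snd : {linear (M * N)%type -> N} := mklin pair_snd_linear.

Lemma pair_short_exact : short_exact pair_inl pair_snd.
Proof.
split=> [x y []//|[x y]|y]; last by exists (0, y).
split=> [/= ->|[z [_ <-]]//]; by exists x.
Qed.

End PairMaps.

(** Resolutions of length at most [n], peeled off one syzygy at a time so that induction on [n]
    applies. For resolving [X] this agrees with [has_resolution]. *)
Fixpoint rdim (R : pzRingType) (X : subcat R) (n : nat) (A : lmodType R) :=
  if n is n'.+1 then
    exists (K X0 : lmodType R) (i : {linear K -> X0}) (p : {linear X0 -> A}),
      [/\ X X0, rdim X n' K & short_exact i p]
  else X A.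

Section Cons.
Variables (R : pzRingType) (A : lmodType R) (C : nat -> lmodType R).
Variables (d : forall i, {linear C i.+1 -> C i}) (f : {linear C 0 -> A}).

Definition cons_mod (i : nat) : lmodType R := if i is i'.+1 then C i' else A.

Definition cons_map (i : nat) : {linear cons_mod i.+1 -> cons_mod i} :=
  match i return {linear C i -> cons_mod i} with 0 => f | i'.+1 => d i' end.

End Cons.

Section Resolving.
Variables (R : pzRingType) (X : subcat R).
Hypotheses (RN : noeth R) (hX : resolving X).
Implicit Types A M N P Q K W : lmodType R.

Let Xfg M : X M -> fin_gen M.
Proof. exact: resolving_fin_gen. Qed.

Lemma kerm_fin_gen M N (f : {linear M -> N}) : fin_gen M -> fin_gen (kerm f).
Proof. by apply: RN; exact: (@kerv_inj _ _ _ f). Qed.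

Lemma resolving_retract M N (s : {linear M -> N}) (r : {linear N -> M}) :
  cancel s r -> X N -> X M.
Proof. by move=> /retract_direct_summand; exact: resolving_summand. Qed.

Lemma resolving_iso M N (f : {linear M -> N}) : bijective f -> X M -> X N.
Proof. by case/linear_inv=> g [_ gK]; exact: resolving_retract gK. Qed.

Lemma resolving_trivial M : trivial_mod M -> X M.
Proof.
move=> M0; apply: (resolving_proj hX); split.
  by exists 0, (fun=> 0) => x; exists (fun=> 0); rewrite big_ord0 (M0 x).
move=> A B g f _; exists \0 => x /=.
by rewrite (M0 x) !linear0.
Qed.

Lemma resolving_pair M N : X M -> X N -> X (M * N)%type.
Proof.
move=> XM XN; have se := pair_short_exact M N.
apply: (resolving_ext hX _ se XM XN).
by apply: (fin_gen_ext se); apply: Xfg.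
Qed.

Lemma rdim_fin_gen n A : rdim X n A -> fin_gen A.
Proof.
case: n => [|n]; first by apply: Xfg.
case=> K [X0 [i [p [XX0 _ [_ _ ps]]]]].
by apply: (fin_gen_surj ps); apply: Xfg.
Qed.

(** Horseshoe argument: the cover of [K] and a free cover [pi] of [P] give a cover [f] of [W], whose
    kernel is an extension of [kerm pi], an object of [X], by the syzygy [K1] of [K]. *)
Lemma rdim_ext n K W P (i : {linear K -> W}) (p : {linear W -> P}) :
  short_exact i p -> rdim X n K -> X P -> rdim X n W.
Proof.
elim: n K W P i p => [|n IH] K W P i p ip /=.
  move=> XK XP; apply: (resolving_ext hX _ ip XK XP).
  by apply: (fin_gen_ext ip); apply: Xfg.
case=> K1 [X0 [j [q [XX0 rK1 [ji jq qs]]]]] XP.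
have [m [pi pis]] := fin_gen_free (Xfg XP).
case: ip => ii ip ps.
have [h hE] := free_projective pi ps.
have fl : linear (fun z : X0 * free_mod R m => i (q z.1) + h z.2).
  by move=> a c d /=; rewrite !linearP /= scalerDr addrACA.
set f : {linear (X0 * free_mod R m)%type -> W} := mklin fl.
have pi0 z : p (i z) = 0 by apply/ip; exists z.
have fs : surj f.
  move=> w; have [c cE] := pis (p w).
  have /ip[k kE] : p (w - h c) = 0 by rewrite linearB hE cE subrr.
  have [x xE] := qs k; exists (x, c) => /=.
  by rewrite xE kE subrK.
exists (kerm f), (X0 * free_mod R m)%type, (kerv f), f; split.
- by apply: resolving_pair => //; apply: (resolving_proj hX (proj_cat_free R m)).
- have Xker : X (kerm pi).
    apply: (resolving_ker hX _ (ker_short_exact pis) _ XP).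
      exact/kerm_fin_gen/free_fin_gen.
    exact: (resolving_proj hX (proj_cat_free R m)).
  have [|u uE] := kerv_lift (f := f) (g := (pair_inl X0 (free_mod R m) \o j)).
    move=> k /=.
    by rewrite (proj2 (jq (j k))) ?linear0 ?addr0//; exists k.
  have [|v vE] := kerv_lift (f := pi) (g := (pair_snd X0 (free_mod R m) \o kerv f)).
    move=> z /=.
    by have := congr1 p (kervK z); rewrite /= linearD pi0 hE add0r linear0.
  apply: (IH _ _ _ u v _ rK1 Xker); split=> [x y uxy|z|c].
  + by apply: ji; have := congr1 (kerv f) uxy; rewrite !uE => -[].
  + split=> [vz|[k kE]].
      have z2 : (kerv f z).2 = 0 by have := vE z; rewrite vz linear0.
      have : i (q (kerv f z).1) + h (kerv f z).2 = 0 := kervK z.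
      rewrite z2 linear0 addr0 => iq0.
      have /jq[k kE] : q (kerv f z).1 = 0 by apply: ii; rewrite iq0 linear0.
      exists k; apply: (@kerv_inj _ _ _ f).
      by rewrite uE /= kE -z2 -surjective_pairing.
    apply: (@kerv_inj _ _ _ pi).
    by rewrite vE -kE /= uE linear0.
  + have /ip[k kE] : p (- h (kerv pi c)) = 0.
      by rewrite linearN hE kervK oppr0.
    have [x xE] := qs k.
    have [z zE] : exists z, kerv f z = (x, kerv pi c).
      by apply: kerv_surj; rewrite /= xE kE addNr.
    by exists z; apply: (@kerv_inj _ _ _ pi); rewrite vE /= zE.
- exact: ker_short_exact.
Qed.

(** The kernel of the composite [X0 -> W -> P] lies in [X] and maps onto [K] with the same kernel
    [W1] as [X0 -> W]. *)
Lemma rdim_ker n K W P (i : {linear K -> W}) (p : {linear W -> P}) :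
  short_exact i p -> rdim X n W -> X P -> rdim X n K.
Proof.
move=> ip; case: n => [|n] /= rW XP.
  apply: (resolving_ker hX _ ip rW XP).
  by case: ip => ii _ _; apply: (RN ii); apply: Xfg.
case: rW => W1 [X0 [j [q [XX0 rW1 [ji jq qs]]]]].
case: ip => ii ip ps; have pi0 z : p (i z) = 0 by apply/ip; exists z.
have pqs : surj (p \o q).
  by move=> y; have [w <-] := ps y; have [x <-] := qs w; exists x.
have XV : X (kerm (p \o q)).
  apply: (resolving_ker hX _ (ker_short_exact pqs) XX0 XP).
  by apply: kerm_fin_gen; apply: Xfg.
have jq0 z : q (j z) = 0 by apply/jq; exists z.
have [|u uE] := kerv_lift (f := (p \o q)) (g := j).
  by move=> z; rewrite /= jq0 linear0.
have [|v vE] := linear_lift ii (linearP (q \o kerv (p \o q))).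
  by move=> z; apply/ip; have := kervK z.
exists W1, (kerm (p \o q)), u, v; split=> //; split=> [x y uxy|z|k].
- by apply: ji; have := congr1 (kerv _) uxy; rewrite !uE.
- split=> [vz|[w wE]].
    have /jq[w wE] : q (kerv (p \o q) z) = 0 by have := vE z; rewrite vz linear0.
    exists w; apply: (@kerv_inj _ _ _ (p \o q)).
    by rewrite uE wE.
  by apply: ii; rewrite vE -wE /= uE jq0 linear0.
- have [x xE] := qs (i k).
  have [z zE] : exists z, kerv (p \o q) z = x.
    by apply: kerv_surj; rewrite /= xE pi0.
  by exists z; apply: ii; rewrite vE /= zE xE.
Qed.

(* The two syzygies of [A] are compared through the pullback of [X0] and [P]
   over [A]. *)
Lemma rdim_syzygy n A K P (i : {linear K -> P}) (p : {linear P -> A}) :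
  short_exact i p -> rdim X n.+1 A -> X P -> rdim X n K.
Proof.
case=> ii ip ps [L [X0 [j [q [XX0 rL [ji jq qs]]]]]] XP.
have ip0 z : p (i z) = 0 by apply/ip; exists z.
have jq0 z : q (j z) = 0 by apply/jq; exists z.
have fl : linear (fun z : X0 * P => q z.1 - p z.2).
  by move=> a c d /=; rewrite !linearP /= scalerDr addrACA.
set f : {linear (X0 * P)%type -> A} := mklin fl.
have fE z : q (kerv f z).1 = p (kerv f z).2.
  by apply/eqP; rewrite -subr_eq0; apply/eqP; exact: (kervK z).
have kf x y : q x = p y -> exists z, kerv f z = (x, y).
  by move=> e; apply: kerv_surj; rewrite /= e subrr.
have [|u uE] := kerv_lift (f := f) (g := (pair_inl X0 P \o j)).
  by move=> z; rewrite /= jq0 linear0 subrr.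
have [|v vE] := kerv_lift (f := f) (g := (pair_inr X0 P \o i)).
  by move=> z; rewrite /= ip0 linear0 subrr.
(* The projection of the pullback to [P] has kernel [L]; the one to [X0], used next, has kernel
   [K]. *)
have rW : rdim X n (kerm f).
  apply: (rdim_ext (i := u) (p := pair_snd X0 P \o kerv f) _ rL XP).
  split=> [x y uxy|z|y].
  - by apply: ji; have := congr1 (kerv f) uxy; rewrite !uE => -[].
  - split=> /= [z2|[w <-]]; last by rewrite uE.
    have /jq[w wE] : q (kerv f z).1 = 0 by rewrite fE z2 linear0.
    exists w; apply: (@kerv_inj _ _ _ f).
    by rewrite uE /= wE -z2 -surjective_pairing.
  - have [x xE] := qs (p y); have [z zE] := kf _ _ xE.
    by exists z; rewrite /= zE.
apply: (rdim_ker (i := v) (p := pair_fst X0 P \o kerv f) _ rW XX0).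
split=> [x y vxy|z|x].
- by apply: ii; have := congr1 (kerv f) vxy; rewrite !vE => -[].
- split=> /= [z1|[w <-]]; last by rewrite vE.
  have /ip[w wE] : p (kerv f z).2 = 0 by rewrite -fE z1 linear0.
  exists w; apply: (@kerv_inj _ _ _ f).
  by rewrite vE /= wE -z1 -surjective_pairing.
- have [y yE] := ps (q x); have [z zE] := kf _ _ (esym yE).
  by exists z; rewrite /= zE.
Qed.

Lemma rdimS n A : rdim X n A -> rdim X n.+1 A.
Proof.
elim: n A => [|n IH] A.
  (* The free module of rank 0 serves as the zero module. *)
  move=> XA; exists (free_mod R 0), A, \0, idfun.
  have t0 (z : free_mod R 0) : z = 0 by apply/ffunP => -[].
  split=> //; first exact: resolving_trivial.
  split=> [x y _|y|y]; first by rewrite (t0 x) (t0 y).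
    by split=> [/= ->|[x <-]//]; exists 0.
  by exists y.
case=> K [X0 [i [p [XX0 rK ip]]]].
by exists K, X0, i, p; split=> //; apply: IH.
Qed.

Lemma rdim_leq m n A : (m <= n)%N -> rdim X m A -> rdim X n A.
Proof.
move=> /subnK <-; elim: (n - m)%N => // d IH rA.
by rewrite addSn; apply/rdimS/IH.
Qed.

Lemma has_resolution_rdim n A : has_resolution X A n -> rdim X n A.
Proof.
elim: n A => [|n IH] A [C [d [e [XC C0 dd de es]]]].
  (* In length 0 the module [C 1] vanishes, so [e] is an isomorphism. *)
  apply: (resolving_iso _ (XC 0%N isT)).
  apply: (linear_bij (f := e)) => //; apply: linear_inj => x /de[y <-].
  by rewrite (C0 1%N isT y) linear0.
have [|f fE] := kerv_lift (f := e) (g := (d 0%N)).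
  by move=> y; apply/de; exists y.
exists (kerm e), (C 0%N), (kerv e), e; split.
- exact: XC.
- apply: IH; exists (fun i => C i.+1), (fun i => d i.+1), f; split.
  + by move=> i; exact: (XC i.+1).
  + by move=> i; exact: (C0 i.+1).
  + by move=> i; exact: (dd i.+1).
  + move=> y; rewrite -dd; split=> [fy|dy].
      by rewrite -fE fy linear0.
    by apply: (@kerv_inj _ _ _ e); rewrite fE dy linear0.
  + move=> y; have /de[x xE] := kervK y; exists x.
    by apply: (@kerv_inj _ _ _ e); rewrite fE.
- exact: ker_short_exact.
Qed.

Lemma rdim_has_resolution n A : rdim X n A -> has_resolution X A n.
Proof.
elim: n A => [|n IH] A.
  move=> XA; pose Z := free_mod R 0.
  have t0 (z : Z) : z = 0 by apply/ffunP => -[].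
  pose C i := if i is 0%N then A else Z.
  exists C, (fun i => (\0 : {linear Z -> C i})).
  exists idfun; split.
  - by case.
  - by case.
  - by move=> [|i] y; split=> [|[x <-]//]; exists 0; rewrite (t0 y).
  - by move=> y; split=> [/= ->|[x <-]//]; exists 0.
  - by move=> y; exists y.
case=> K [X0 [i [p [XX0 /IH[C [d [e [XC C0 dd de es]]]] [ii ip ps]]]]].
exists (cons_mod X0 C), (cons_map d (i \o e)), p; split=> //.
- by case=> //= k; exact: XC.
- by case=> //= k; exact: C0.
- case=> [|k] y; last exact: dd.
  split=> [/= ie|[x <-]].
    by apply/de/ii; rewrite ie linear0.
  have e0 : e (d 0%N x) = 0 by apply/de; exists x.
  by rewrite /= e0 linear0.
- move=> y; rewrite ip; split=> [[x <-]|[z <-]]; last by exists (e z).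
  by have [z <-] := es x; exists z.
Qed.

(** Reduces the dimension to finite bounds: the infinite value satisfies none, and a resolution of
    minimal length can be lengthened by [rdim_leq]. *)
Lemma resdim_leP n A : enat_le (resdim X A) (Some n) <-> rdim X n A.
Proof.
rewrite /resdim /enat_inf; case: pselect => [exP|nexP] /=.
  case: ex_minnP => m /asboolP/has_resolution_rdim rm mmin.
  split=> [mn|/rdim_has_resolution rn]; first exact: rdim_leq rm.
  exact/mmin/asboolP.
split=> // /rdim_has_resolution rn; case: nexP; exists n; exact/asboolP.
Qed.

End Resolving.

Lemma enat_sup_leP (S : enat -> Prop) n :
  enat_le (enat_sup S) (Some n) <-> forall x, S x -> enat_le x (Some n).
Proof.
rewrite /enat_sup /enat_inf; case: pselect => [exP|nexP] /=.
  case: ex_minnP => m /asboolP ub mmin.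
  split=> [mn x /ub|ubn]; last exact/mmin/asboolP.
  by case: x => //= p /leq_trans; exact.
by split=> // ubn; case: nexP; exists n; exact/asboolP.
Qed.

Lemma resdim_mod_leP (R : pzRingType) (X : subcat R) n :
  noeth R -> resolving X ->
  enat_le (resdim_mod X) (Some n) <-> forall A, fin_gen A -> rdim X n A.
Proof.
move=> RN hX; rewrite /resdim_mod enat_sup_leP; split=> [h A fA|h _ [A fA ->]].
  by apply/resdim_leP => //; apply: h; exists A.
by apply/resdim_leP => //; apply: h.
Qed.

(** * Regular maps in exact sequences *)

Section Regular.
Variables (R : pzRingType) (X : subcat R).
Implicit Types A M N P Q K W Z : lmodType R.

Definition regular M N (f : {linear M -> N}) : Prop :=
  exists u : {linear N -> M}, forall x, f (u (f x)) = f x.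

(** Contravariant finiteness of [X], with surjective right approximations. *)
Definition has_approx : Prop := forall K, fin_gen K ->
  exists (X0 : lmodType R) (p : {linear X0 -> K}), [/\ X X0, surj p &
    forall M (f : {linear M -> K}), X M ->
      exists g : {linear M -> X0}, forall x, p (g x) = f x].

(** Each [d i.+1] is a weak kernel of [d i] in [X]; there is no exactness condition at [C 0]. *)
Definition resolving_chain (C : nat -> lmodType R)
    (d : forall i, {linear C i.+1 -> C i}) : Prop :=
  [/\ forall i, X (C i), forall i x, d i (d i.+1 x) = 0 &
    forall i M (a : {linear M -> C i.+1}), X M -> (forall x, d i (a x) = 0) ->
      exists b : {linear M -> C i.+2}, forall x, a x = d i.+1 (b x)].

(** Dually, each [y i.+1] is a weak cokernel of [y i] in [X]. *)
Definition coresolving_chain (Y : nat -> lmodType R)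
    (y : forall i, {linear Y i -> Y i.+1}) : Prop :=
  [/\ forall i, X (Y i), forall i x, y i.+1 (y i x) = 0 &
    forall i Z (a : {linear Y i.+1 -> Z}), X Z -> (forall x, a (y i x) = 0) ->
      exists b : {linear Y i.+2 -> Z}, forall x, a x = b (y i.+1 x)].

Definition chain_regular (n : nat) : Prop :=
  forall (C : nat -> lmodType R) (d : forall i, {linear C i.+1 -> C i}),
    resolving_chain d -> regular (d n).

Definition cochain_regular (n : nat) : Prop :=
  forall (Y : nat -> lmodType R) (y : forall i, {linear Y i -> Y i.+1}),
    coresolving_chain y -> regular (y n).

(** Since [d u d = d], the map [x - d (u x)] kills the image of [d]; it factors through [p], and the
    factor is the section. *)
Lemma regular_section M N K (d : {linear M -> N}) (p : {linear N -> K}) :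
  exact d p -> surj p -> regular d -> exists s : {linear K -> N}, cancel s p.
Proof.
move=> dp ps [u uE].
have fl : linear (fun x => x - d (u x)).
  by move=> a x y; rewrite !linearP /= scalerDr addrACA.
have [|s sE] := linear_factor (f := mklin fl) ps.
  by move=> x /dp[w <-] /=; rewrite uE subrr.
exists s => k; have [x <-] := ps k; rewrite sE /= linearB.
have -> : p (d (u x)) = 0 by apply/dp; exists (u x).
by rewrite subr0.
Qed.

Hypotheses (RN : noeth R) (hX : resolving X) (Xapp : has_approx).

Section Coresolving.
Variables (Y : nat -> lmodType R) (y : forall i, {linear Y i -> Y i.+1}).
Hypothesis yY : coresolving_chain y.

(* The functor [Hom(Y, -)] shifts degrees along the syzygies of [K]. *)
Lemma coresolving_exact m K j (a : {linear Y j.+1 -> K}) :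
  rdim X m K -> (m <= j)%N -> (forall x, a (y j x) = 0) ->
  exists b : {linear Y j.+2 -> K}, forall x, a x = b (y j.+1 x).
Proof.
have [XY yy yex] := yY.
elim: m K j a => [|m IH] K j a rK; first by move=> _; apply: yex.
case: j a => // j a; rewrite ltnS => mj ay.
have [X0 [p [XX0 ps plift]]] := Xapp (rdim_fin_gen hX rK).
have rK' := rdim_syzygy RN hX (ker_short_exact ps) rK XX0.
(* The lift [t] of [a] sends the image of [y j.+1] into the syzygy [kerm p]. Induction one degree
   lower extends this restriction to [c], and [t] corrected by [c] kills [y j.+1], hence factors
   through [y j.+2]. *)
have [t tE] := plift _ a (XY _).
have [|c0 c0E] := kerv_lift (f := p) (g := t \o y j.+1).
  by move=> z; rewrite /= tE ay.
have [|c cE] := IH _ _ c0 rK' mj.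
  by move=> x; apply: (@kerv_inj _ _ _ p); rewrite c0E /= yy !linear0.
have [||b bE] := yex j.+1 _ (t \- (kerv p \o c)).
- exact: XX0.
- by move=> x /=; rewrite -cE c0E /= subrr.
exists (p \o b) => x /=.
by rewrite -bE /= linearB kervK tE subr0.
Qed.

End Coresolving.

Section Image.
Variables (M N : lmodType R) (f : {linear M -> N}).

Lemma im_coker_short_exact :
  short_exact (imv f) (quotp (im_submod f)).
Proof.
split; [exact: smval_inj | | exact: quotp_surj].
move=> z; rewrite quotp_eq0; split=> [|[u <-]]; first exact: smval_surj.
exact: smvalP.
Qed.

(** The image is a first syzygy of the cokernel. *)
Lemma rdim_im n : (forall A, fin_gen A -> rdim X n.+1 A) -> X N ->
  rdim X n (imm f).
Proof.
move=> h XN; apply: (rdim_syzygy RN hX im_coker_short_exact _ XN).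
apply: h; apply: (fin_gen_surj (@quotp_surj _ _ _)).
exact: (resolving_fin_gen hX XN).
Qed.

End Image.

Lemma cochain_regular_rdim n :
  (forall A, fin_gen A -> rdim X n A) ->
  (1 < n)%N \/ (forall M, X M -> projective M) ->
  cochain_regular n.
Proof.
move=> hn n2 Y y yY; have [XY yy yex] := yY.
have [g [gs gE]] := im_factor (y n).
case: n n2 hn g gs gE => [|[|n]] n2 hn g gs gE.
(* Degree 0: the cokernel is projective, so the image is a summand of [Y 1], hence projective, and
   [g] splits. *)
- have {n2}Xp : forall M, X M -> projective M by case: n2.
  have se := im_coker_short_exact (y 0%N).
  have Ap := Xp _ (hn _ (fin_gen_surj
                 (@quotp_surj _ _ (im_submod (y 0%N))) (resolving_fin_gen hX (XY 1%N)))).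
  have [r [_ [rK _ _]]] := short_exact_split se Ap.
  have Ip := projective_retract rK (Xp _ (XY 1%N)).
  have [s sK] := projective_split Ip gs.
  by exists (s \o r) => x /=; rewrite -!gE rK sK.
(* Degree 1: the image is projective, so [g] has a section [s]; the idempotent [s g] kills [y 0] and
   so factors through [y 1]. *)
- have {n2}Xp : forall M, X M -> projective M by case: n2.
  have [s sK] := projective_split (Xp _ (rdim_im (y 1%N) hn (XY 2%N))) gs.
  have [||b bE] := yex 0%N _ (s \o g).
  + exact: XY.
  + move=> x /=; have -> : g (y 0%N x) = 0; last by rewrite linear0.
    by apply: (@smval_inj _ _ (im_submod (y 1%N))); rewrite gE yy linear0.
  by exists b => x; rewrite -bE /= -gE sK gE.
(* Degree [n + 2]: the kernel is a second syzygy of the cokernel and has dimension at most [n]. So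
   [y n.+1], seen as a map into the kernel, is [c] after [y n.+1]; the identity minus [c] then kills
   [y n.+1] and factors through [y n.+2]. *)
- have gk : short_exact (kerv (y n.+2)) g.
    split=> [|z|//]; first exact: kerv_inj.
    split=> [gz|[w <-]].
      by apply: kerv_surj; rewrite -gE gz linear0.
    by apply: (@smval_inj _ _ (im_submod (y n.+2))); rewrite gE kervK linear0.
  have rk := rdim_syzygy RN hX gk (rdim_im (y n.+2) hn (XY _)) (XY _).
  have [c0 c0E] := kerv_lift (f := y n.+2) (g := y n.+1) (yy _).
  have [|c cE] := coresolving_exact yY rk (leqnn n) (a := c0).
    move=> x; apply: (@kerv_inj _ _ _ (y n.+2)).
    by rewrite c0E yy linear0.
  have [||b bE] := yex n.+1 _ (idfun \- (kerv (y n.+2) \o c)).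
  + exact: XY.
  + by move=> x /=; rewrite -cE c0E subrr.
  by exists b => x; rewrite -bE /= linearB kervK subr0.
Qed.

(** * Resolutions by iterated right approximations *)

Section Resolution.
Variable ap : forall K, {X0 : lmodType R & {linear X0 -> K}}.
Hypothesis apP : forall K, fin_gen K ->
  [/\ X (projT1 (ap K)), surj (projT2 (ap K)) &
    forall M (f : {linear M -> K}), X M ->
      exists g : {linear M -> projT1 (ap K)}, forall x, projT2 (ap K) (g x) = f x].
Variable A : lmodType R.
Hypothesis Afg : fin_gen A.

Fixpoint res_syz (i : nat) : lmodType R :=
  if i is i'.+1 then kerm (projT2 (ap (res_syz i'))) else A.
Definition res_mod i : lmodType R := projT1 (ap (res_syz i)).
Definition res_cover i : {linear res_mod i -> res_syz i} := projT2 (ap (res_syz i)).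
Definition res_incl i : {linear res_syz i.+1 -> res_mod i} := kerv (res_cover i).
Definition res_diff i : {linear res_mod i.+1 -> res_mod i} :=
  res_incl i \o res_cover i.+1.

Lemma res_mod_syz i : X (res_mod i) /\ fin_gen (res_syz i).
Proof.
have [] // : fin_gen (res_syz i) /\ X (res_mod i).
elim: i => [|i [fi Xi]]; first by split=> //; case: (apP Afg).
have fSi : fin_gen (res_syz i.+1).
  by apply: kerm_fin_gen => //; apply: (resolving_fin_gen hX).
by split=> //; case: (apP fSi).
Qed.

Lemma res_short_exact i : short_exact (res_incl i) (res_cover i).
Proof.
by apply: ker_short_exact; have [_ /apP[]] := res_mod_syz i.
Qed.

Lemma res_lift i M (a : {linear M -> res_mod i}) : X M ->
  (forall x, res_cover i (a x) = 0) ->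
  exists b : {linear M -> res_mod i.+1}, forall x, a x = res_diff i (b x).
Proof.
move=> XM /kerv_lift[u uE]; have [_ /apP[_ _ lift]] := res_mod_syz i.+1.
by have [b bE] := lift _ u XM; exists b => x; rewrite -uE -bE.
Qed.

Lemma res_cover_diff i x : res_cover i (res_diff i x) = 0.
Proof. exact: kervK. Qed.

Lemma res_diffK i x : res_diff i (res_diff i.+1 x) = 0.
Proof. by rewrite /= -/(res_diff _ _) res_cover_diff linear0. Qed.

Lemma res_diff_exact i : exact (res_diff i) (res_cover i).
Proof.
move=> x; split=> [/kerv_surj[k <-]|[z <-]]; last exact: res_cover_diff.
have [_ _ cs] := res_short_exact i.+1.
by have [z <-] := cs k; exists z.
Qed.

Lemma res_resolving_chain : resolving_chain res_diff.
Proof.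
split=> [i|i x|i M a XM da]; first by case: (res_mod_syz i).
  exact: res_diffK.
apply: res_lift => // x; apply: (@kerv_inj _ _ _ (res_cover i)).
by rewrite linear0; exact: da.
Qed.

Lemma rdim_res_syz m i : X (res_syz (i + m)) -> rdim X m (res_syz i).
Proof.
elim: m i => [|m IH] i; first by rewrite addn0.
rewrite addnS -addSn => /IH rm.
exists (res_syz i.+1), (res_mod i), (res_incl i), (res_cover i).
by split=> //; [case: (res_mod_syz i) | exact: res_short_exact].
Qed.

End Resolution.

Lemma approx_fun : exists ap : forall K, {X0 : lmodType R & {linear X0 -> K}},
  forall K, fin_gen K ->
  [/\ X (projT1 (ap K)), surj (projT2 (ap K)) &
    forall M (f : {linear M -> K}), X M ->
      exists g : {linear M -> projT1 (ap K)}, forall x, projT2 (ap K) (g x) = f x].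
Proof.
suff h K : exists q : {X0 : lmodType R & {linear X0 -> K}}, fin_gen K ->
    [/\ X (projT1 q), surj (projT2 q) &
    forall M (f : {linear M -> K}), X M ->
      exists g : {linear M -> projT1 q}, forall x, projT2 q (g x) = f x].
  by exists (fun K => sval (cid (h K))) => K; case: cid.
have [fK|nfK] := pselect (fin_gen K); last first.
  (* A total choice function needs a value on modules that are not finitely generated; the identity
     is a default. *)
  by exists (existT _ K (idfun : {linear K -> K})) => /nfK.
have [X0 [p hp]] := Xapp fK.
by exists (existT _ X0 p).
Qed.

(** Regularity in degree [n] splits the approximation of the [n]-th syzygy, which thereby lies in
    [X] and ends the resolution. *)
Lemma chain_regular_rdim n : chain_regular n ->
  forall A, fin_gen A -> rdim X n A.
Proof.
move=> cn A fA; have [ap apP] := approx_fun.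
apply: (rdim_res_syz apP fA (i := 0)).
have reg := cn _ _ (res_resolving_chain apP fA).
have [_ _ ps] := res_short_exact apP fA n.
have [s sK] := regular_section (@res_diff_exact _ apP _ fA n) ps reg.
by apply: (resolving_retract hX sK); case: (res_mod_syz apP fA n).
Qed.

(** A free cover [p] of [M] followed by an approximation resolution of its kernel is a chain in [X];
    regularity in degree 1 splits [p]. *)
Lemma chain_regular1_projective : chain_regular 1 ->
  forall M, X M -> projective M.
Proof.
move=> c1 M XM; have [m [p ps]] := fin_gen_free (resolving_fin_gen hX XM).
have fA := kerm_fin_gen RN p (free_fin_gen R m).
have [ap apP] := approx_fun.
(* [M] sits in degree 0 and its free cover in degree 1, so that [d 1] is [d0], whose image is the
   kernel of [p]. *)
pose C := cons_mod M (cons_mod (free_mod R m) (res_mod ap (kerm p))).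
pose d0 : {linear res_mod ap (kerm p) 0 -> free_mod R m} :=
  kerv p \o res_cover ap (kerm p) 0.
pose d : forall i, {linear C i.+1 -> C i} :=
  @cons_map R M (cons_mod (free_mod R m) (res_mod ap (kerm p)))
    (cons_map (res_diff ap (kerm p)) d0) p.
have [_ _ cs] := res_short_exact apP fA 0.
have d0p : exact d0 p.
  move=> x; split=> [/kerv_surj[k <-]|[z <-]]; last exact: kervK.
  by have [z <-] := cs k; exists z.
suff /c1[u uE] : resolving_chain d.
  have [|s sK] := regular_section d0p ps; first by exists u.
  exact: projective_retract sK (@free_projective R m).
split.
- case=> [|[|i]] //; first exact: (resolving_proj hX (proj_cat_free R m)).
  by case: (res_mod_syz apP fA i).
- case=> [|[|i]] x; first exact: kervK.
    rewrite /= /d0 /=; have := @res_cover_diff ap (kerm p) 0 x.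
    by move=> /= ->; rewrite linear0.
  exact: res_diffK.
- case=> [|[|i]] N a XN da.
  + have [u uE] := kerv_lift da; have [_ _ lift] := apP _ fA.
    by have [b bE] := lift _ u XN; exists b => x; rewrite /= bE uE.
  + apply: (res_lift apP fA) => // x; apply: (@kerv_inj _ _ _ p).
    by rewrite linear0; exact: da.
  + by have [_ _ ex] := res_resolving_chain apP fA; exact: ex.
Qed.

End Regular.

(** * Direct summands of finite powers of a module *)

Section AddCoord.
Variable R : pzRingType.
Implicit Types M N P U V : lmodType R.

Fact lin_sum_linear M N n (f : 'I_n -> {linear M -> N}) :
  linear (fun x => \sum_i f i x).
Proof.
move=> a x y; rewrite scaler_sumr -big_split; apply: eq_bigr => i _.
by rewrite linearP.
Qed.

Definition lin_sum M N n (f : 'I_n -> {linear M -> N}) : {linear M -> N} :=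
  mklin (lin_sum_linear f).

(** Membership in [add U] in coordinates: the identity is a sum of maps through [U], an equation
    that additive functors visibly preserve. *)
Definition add_coord U M : Prop :=
  exists n (s : 'I_n -> {linear U -> M}) (r : 'I_n -> {linear M -> U}),
    forall x, x = \sum_i s i (r i x).

Lemma add_coord_self U : add_coord U U.
Proof.
by exists 1%N, (fun=> idfun), (fun=> idfun) => x; rewrite big_ord1.
Qed.

Lemma add_coord_iso U V M : mod_iso U V -> add_coord U M -> add_coord V M.
Proof.
case=> f /linear_inv[g [fK gK]] [n [s [r sr]]].
exists n, (fun i => s i \o g), (fun i => f \o r i) => x.
rewrite {1}(sr x); apply: eq_bigr => i _ /=.
by rewrite fK.
Qed.

Section Power.
Variables (U : lmodType R) (n : nat).
Let Un : lmodType R := {ffun 'I_n -> U}.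

Fact ffun_proj_linear i : linear (fun c : Un => c i).
Proof. by move=> a c d; rewrite !ffunE. Qed.
Definition ffun_proj i : {linear Un -> U} := mklin (ffun_proj_linear i).

Fact ffun_inj_linear i : linear (fun x : U => [ffun j => if i == j then x else 0] : Un).
Proof.
move=> a x y; apply/ffunP => j; rewrite !ffunE.
by case: eqP => //; rewrite scaler0 addr0.
Qed.
Definition ffun_inj i : {linear U -> Un} := mklin (ffun_inj_linear i).

Lemma ffun_inj_proj (c : Un) : c = \sum_i ffun_inj i (ffun_proj i c).
Proof.
apply/ffunP => j; rewrite sum_ffunE (bigD1 j)//= big1 => [|i ij].
  by rewrite ffunE eqxx addr0.
by rewrite ffunE (negbTE ij).
Qed.

Lemma add_coord_retract M (s : {linear M -> Un}) (r : {linear Un -> M}) :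
  cancel s r -> add_coord U M.
Proof.
move=> sK; exists n, (fun i => r \o ffun_inj i), (fun i => ffun_proj i \o s) => x.
by rewrite -linear_sum -ffun_inj_proj sK.
Qed.

End Power.

Lemma add_coordP U M : add_coord U M <->
  exists n (s : {linear M -> {ffun 'I_n -> U}}) (r : {linear {ffun 'I_n -> U} -> M}),
    cancel s r.
Proof.
split=> [[n [s [r sr]]]|[n [s [r sK]]]]; last exact: add_coord_retract sK.
pose i : {linear M -> {ffun 'I_n -> U}} :=
  lin_sum (fun k => @ffun_inj U n k \o r k).
exists n, i, (lin_sum (fun k => s k \o @ffun_proj U n k)) => x.
rewrite {2}(sr x) /=; apply: eq_bigr => k _; congr (s k _).
rewrite sum_ffunE (bigD1 k)//= big1 => [|j jk].
  by rewrite ffunE eqxx addr0.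
by rewrite ffunE (negbTE jk).
Qed.

Lemma add_catP U M : add_cat U M <-> add_coord U M.
Proof.
rewrite add_coordP; split=> [[n /direct_summand_retract[s [r sK]]]|].
  by exists n, s, r.
by case=> n [s [r /retract_direct_summand]]; exists n.
Qed.

Lemma proj_catP P : proj_cat P <-> add_coord (R^o : lmodType R) P.
Proof.
rewrite add_coordP; split=> [[/fin_gen_free[n [p ps]] Pp]|[n [s [r sK]]]].
  by have [s sK] := projective_split Pp ps; exists n, s, p.
split; first exact: fin_gen_retract sK (free_fin_gen R n).
exact: projective_retract sK (@free_projective R n).
Qed.

End AddCoord.

(** * The duality [Hom(-, T)] *)

Lemma linear_ext (R : pzRingType) (M N : lmodType R) (f g : {linear M -> N}) :
  f =1 g -> f = g.
Proof.
case: f g => [f [[[f1 f2]] [fs]]] [g [[[g1 g2]] [gs]]] /= /funext fg; subst g.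
by congr GRing.Linear.Pack; congr GRing.Linear.Class; congr (_ _);
  exact: Prop_irrelevance.
Qed.

(** A bimodule structure on [T]. It is used for [End T] acting on [T], for [R] acting on [T] over
    [End T], and for central scalars acting on a module. *)
Record is_action (R S : pzRingType) (T : lmodType R)
    (act : S -> {linear T -> T}) : Prop := IsAction {
  act1 : forall t, act 1 t = t;
  actM : forall a b t, act (a * b) t = act a (act b t);
  actD : forall a b t, act (a + b) t = act a t + act b t
}.

Section Dual.
Variables (R S : pzRingType) (T : lmodType R) (act : S -> {linear T -> T}).
Variable actP : is_action act.
Implicit Types M N : lmodType R.

(** The proof [h] is an argument of the type so that instance inference finds the module structure
    built from it. *)
Definition dual_mod (h : is_action act) (M : lmodType R) := {linear M -> T}.

HB.instance Definition _ h M := gen_eqMixin (dual_mod h M).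
HB.instance Definition _ h M := gen_choiceMixin (dual_mod h M).

Section Structure.
Variables (M : lmodType R).
Local Notation D := (dual_mod actP M).
Definition dual_add (f g : D) : D := f \+ g.
Definition dual_opp (f : D) : D := \- f.
Definition dual_zero : D := \0.
Definition dual_scale (a : S) (f : D) : D := act a \o f.
Fact dual_addA : associative dual_add.
Proof. by move=> f g h; apply: linear_ext => x /=; rewrite addrA. Qed.
Fact dual_addC : commutative dual_add.
Proof. by move=> f g; apply: linear_ext => x /=; rewrite addrC. Qed.
Fact dual_add0 : left_id dual_zero dual_add.
Proof. by move=> f; apply: linear_ext => x /=; rewrite add0r. Qed.
Fact dual_addN : left_inverse dual_zero dual_opp dual_add.
Proof. by move=> f; apply: linear_ext => x /=; rewrite addNr. Qed.
HB.instance Definition _ := GRing.isZmodule.Build D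
  dual_addA dual_addC dual_add0 dual_addN.
Fact dual_scaleA a b f : dual_scale a (dual_scale b f) = dual_scale (a * b) f.
Proof. by apply: linear_ext => x /=; rewrite (actM actP). Qed.
Fact dual_scale1 : left_id 1 dual_scale.
Proof. by move=> f; apply: linear_ext => x /=; rewrite (act1 actP). Qed.
Fact dual_scaleDr : right_distributive dual_scale +%R.
Proof. by move=> a f g; apply: linear_ext => x /=; rewrite linearD. Qed.
Fact dual_scaleDl f : {morph dual_scale^~ f : a b / a + b}.
Proof. by move=> a b; apply: linear_ext => x /=; rewrite (actD actP). Qed.
HB.instance Definition _ := GRing.Zmodule_isLmodule.Build S D
  dual_scaleA dual_scale1 dual_scaleDr dual_scaleDl.
End Structure.

Local Notation D M := (dual_mod actP M : lmodType S).

Lemma dual_addE M (f g : D M) x : (f + g : D M) x = f x + g x.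
Proof. by []. Qed.
Lemma dual_scaleE M a (f : D M) x : (a *: f : D M) x = act a (f x).
Proof. by []. Qed.
Lemma dual_sumE M n (f : 'I_n -> D M) x : (\sum_i f i : D M) x = \sum_i f i x.
Proof.
elim: n f => [|n IH] f; first by rewrite !big_ord0.
by rewrite !big_ord_recl dual_addE IH.
Qed.

Fact dual_map_linear M N (f : {linear M -> N}) :
  linear (fun g : D N => (g \o f : {linear M -> T}) : D M).
Proof. by move=> a g h; apply: linear_ext. Qed.

Definition dual_map M N (f : {linear M -> N}) : {linear D N -> D M} :=
  mklin (dual_map_linear f).

Lemma dual_mapE M N (f : {linear M -> N}) (g : D N) x :
  (dual_map f g : D M) x = g (f x).
Proof. by []. Qed.

Lemma dual_add_coord U M : add_coord U M -> add_coord (D U) (D M).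
Proof.
case=> n [s [r sr]].
exists n, (fun i => dual_map (r i)), (fun i => dual_map (s i)) => g.
apply: linear_ext => x; rewrite dual_sumE {1}(sr x) linear_sum.
by apply: eq_bigr.
Qed.

Variable U : lmodType R.
Hypothesis U_full : forall psi : {linear D U -> D U},
  exists phi : {linear U -> U}, forall (g : D U) x, psi g x = g (phi x).
Hypothesis U_faithful : forall phi : {linear U -> U},
  (forall (g : D U) x, g (phi x) = 0) -> forall x, phi x = 0.

(** Coordinates cut [psi] into a matrix of endomorphisms of [D U]; each entry is dual to an
    endomorphism of [U], and these are reassembled. *)
Lemma dual_full M N (psi : {linear D N -> D M}) :
  add_coord U M -> add_coord U N ->
  exists phi : {linear M -> N}, forall (g : D N) x, psi g x = g (phi x).
Proof.
move=> [m [s [r sr]]] [n [t [q tq]]].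
have [phi phiE] := choice (fun ij : 'I_m * 'I_n =>
  U_full (dual_map (s ij.1) \o (psi \o dual_map (q ij.2)))).
exists (lin_sum (fun i => lin_sum (fun j => t j \o (phi (i, j) \o r i)))) => g x.
rewrite {1}(sr x) !linear_sum /=; apply: eq_bigr => i _.
have gE : g = \sum_j (dual_map (q j) (dual_map (t j) g)).
  by apply: linear_ext => y; rewrite dual_sumE {1}(tq y) linear_sum.
rewrite {1}gE linear_sum dual_sumE linear_sum; apply: eq_bigr => j _.
by have := phiE (i, j) (dual_map (t j) g) (r i x).
Qed.

Lemma dual_faithful M N (phi : {linear M -> N}) :
  add_coord U M -> add_coord U N ->
  (forall (g : D N) x, g (phi x) = 0) -> forall x, phi x = 0.
Proof.
move=> [m [s [r sr]]] [n [t [q tq]]] h x.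
rewrite (tq (phi x)) big1// => j _; rewrite (sr x) !linear_sum big1// => i _.
suff -> : q j (phi (s i (r i x))) = 0 by rewrite linear0.
apply: (U_faithful (phi := q j \o (phi \o s i))) => g y.
exact: (h (dual_map (q j) g) (s i y)).
Qed.

Variables (X : subcat R) (X' : subcat S).
Hypothesis XU : X U.
Hypothesis XP : forall M, X M -> add_coord U M.
Hypothesis X'P : forall P, X' P <-> add_coord (D U) P.

(** Hom(-, T) turns a chain in [X] into a cochain in [X']; fullness brings the quasi-inverse back
    and faithfulness verifies it. *)
Lemma chain_regular_dual n : cochain_regular X' n -> chain_regular X n.
Proof.
move=> co C d [XC dd dex].
pose y i : {linear D (C i) -> D (C i.+1)} := dual_map (d i).
have yco : coresolving_chain X' y.
  split=> [i|i g|i Z a /X'P[m [s [r sr]]] ay].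
  - exact/X'P/dual_add_coord/XP.
  - by apply: linear_ext => x; rewrite !dual_mapE dd linear0.
  (* Each coordinate of [a] is a map into [D U], hence dual to some [phi] from [U]. By faithfulness
     [d i] kills [phi], so exactness of the chain lifts it to [b]. *)
  - have h k : exists b : {linear U -> C i.+2},
        forall (g : D (C i.+1)) x, r k (a g) x = g (d i.+1 (b x)).
      have [phi phiE] := dual_full (r k \o a) (XP XU) (XP (XC i.+1)).
      have [|b bE] := dex i _ phi XU.
        apply: (@dual_faithful _ _ (d i \o phi)); [exact: XP|exact: XP|].
        move=> g x; rewrite /= -(dual_mapE (d i) g) -phiE /= ay.
        by rewrite linear0.
      by exists b => g x; rewrite -bE -phiE.
    have [b bE] := choice h.
    exists (lin_sum (fun k => s k \o dual_map (b k))) => g /=.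
    rewrite {1}(sr (a g)); apply: eq_bigr => k _; congr (s k _).
    by apply: linear_ext => x; rewrite bE.
have [psi psiE] := co _ _ yco.
have [u uE] := dual_full psi (XP (XC n)) (XP (XC n.+1)).
exists u => x; apply/eqP; rewrite -subr_eq0; apply/eqP.
apply: (@dual_faithful _ _ ((d n \o (u \o d n)) \- d n)); [exact: XP|exact: XP|].
move=> g z /=; rewrite linearB; apply/eqP; rewrite subr_eq0; apply/eqP.
have := congr1 (fun f : D (C n.+1) => f z) (psiE g).
by rewrite /y dual_mapE uE.
Qed.

End Dual.

(** * The duality between [add T] and projective modules over [End T] *)

Section Auslander.
Variables (R : pzRingType) (T : lmodType R).

Local Notation S := ((auslander_algebra T)^c).

Definition endo_act (e : S) : {linear T -> T} := e.

Fact endo_actP : is_action endo_act.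
Proof. by []. Qed.

(** An alias of [T] carrying its structure over the endomorphism ring, on which [R] acts by
    [aus_act]. *)
Definition aus_mod : Type := T.
HB.instance Definition _ := GRing.Zmodule.on aus_mod.

Fact aus_scaleA (a b : S) (t : aus_mod) :
  endo_act a (endo_act b t) = endo_act (a * b) t.
Proof. by []. Qed.
Fact aus_scale1 : left_id (1 : S) (fun e (t : aus_mod) => endo_act e t : aus_mod).
Proof. by []. Qed.
Fact aus_scaleDr :
  right_distributive (fun (e : S) (t : aus_mod) => endo_act e t : aus_mod) +%R.
Proof. by move=> e x y /=; rewrite linearD. Qed.
Fact aus_scaleDl (t : aus_mod) :
  {morph (fun e : S => endo_act e t : aus_mod) : a b / a + b}.
Proof. by []. Qed.
HB.instance Definition _ := GRing.Zmodule_isLmodule.Build S aus_mod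
  aus_scaleA aus_scale1 aus_scaleDr aus_scaleDl.

Lemma aus_scaleE (e : S) (t : aus_mod) : e *: t = endo_act e t.
Proof. by []. Qed.

Fact aus_act_linear (a : R) : linear (fun t : aus_mod => (a *: (t : T) : aus_mod)).
Proof. by move=> e x y; rewrite !aus_scaleE scalerDr linearZ_LR. Qed.
Definition aus_act (a : R) : {linear aus_mod -> aus_mod} := mklin (aus_act_linear a).

Fact aus_actP : is_action aus_act.
Proof.
split=> [t|a b t|a b t].
- exact: (scale1r (t : T)).
- exact/esym/(scalerA a b (t : T)).
- exact: (scalerDl (t : T) a b).
Qed.

Definition aus_reg : lmodType S := S^o.
Definition aus_dual : lmodType R := dual_mod aus_actP aus_reg.

Definition aus_app (h : aus_dual) : {linear aus_reg -> aus_mod} := h.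

Lemma aus_dual_ext (g h : aus_dual) : aus_app g =1 aus_app h -> g = h.
Proof. exact: linear_ext. Qed.

Lemma aus_appP a (g h : aus_dual) x :
  aus_app (a *: g + h) x = aus_act a (aus_app g x) + aus_app h x.
Proof. by []. Qed.

Fact aus_rho_linear (t : aus_mod) : linear (fun e : aus_reg => (e : S) *: t).
Proof. by move=> a x y; rewrite scalerDl scalerA. Qed.
Definition aus_rho t : aus_dual := mklin (aus_rho_linear t).

Lemma aus_rhoE t (e : S) : aus_app (aus_rho t) e = e *: t.
Proof. by []. Qed.

Lemma aus_appE (h : aus_dual) (e : S) : aus_app h e = e *: aus_app h (1 : S).
Proof. by rewrite -linearZ_LR; congr (aus_app h _); rewrite -[RHS]/(e * 1) mulr1. Qed.

Lemma aus_rhoK (h : aus_dual) : aus_rho (aus_app h (1 : S)) = h.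
Proof. by apply: aus_dual_ext => e; rewrite aus_rhoE -aus_appE. Qed.

Fact aus_rho_linear2 : linear (fun t : T => aus_rho t).
Proof.
move=> a x y; apply: aus_dual_ext => e.
by rewrite aus_appP !aus_rhoE !aus_scaleE linearP.
Qed.

(** The dual of [T] is generated over [S] by the identity, so [psi] is determined by its value
    there. *)
Lemma endo_full (psi : {linear dual_mod endo_actP T -> dual_mod endo_actP T}) :
  exists phi : {linear T -> T}, forall (g : dual_mod endo_actP T) x,
    psi g x = g (phi x).
Proof.
pose one : dual_mod endo_actP T := (idfun : {linear T -> T}).
exists (psi one) => g x.
have -> : g = (g : S) *: one by apply: linear_ext.
by rewrite linearZ_LR dual_scaleE.
Qed.

Lemma endo_faithful (phi : {linear T -> T}) :
  (forall (g : dual_mod endo_actP T) x, g (phi x) = 0) -> forall x, phi x = 0.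
Proof. by move=> h x; exact: (h (idfun : {linear T -> T})). Qed.

Lemma endo_dual_iso : mod_iso (S^o : lmodType S) (dual_mod endo_actP T).
Proof.
have fl : linear (fun e : S^o => (e : S) : dual_mod endo_actP T).
  by move=> a x y; apply: linear_ext.
exists (mklin fl); exists (fun g : dual_mod endo_actP T => (g : S)) => //.
Qed.

(** Under the identification of [aus_dual] with [T] by evaluation at 1, [psi] becomes an
    endomorphism [g] of [T], and it is dual to right multiplication by [g]. *)
Lemma aus_full (psi : {linear aus_dual -> aus_dual}) :
  exists phi : {linear aus_reg -> aus_reg},
    forall (g : aus_dual) x, aus_app (psi g) x = aus_app g (phi x).
Proof.
have gl : linear (fun t : T => aus_app (psi (aus_rho t)) (1 : S) : T).
  by move=> a x y; rewrite aus_rho_linear2 linearP aus_appP.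
pose g : S := mklin gl.
have pl : linear (fun e : aus_reg => (e : S) * g : aus_reg).
  by move=> a x y; rewrite mulrDl -mulrA.
exists (mklin pl) => h x.
rewrite (aus_appE (psi h)) (aus_appE h) /= -scalerA; congr (_ *: _).
by rewrite aus_scaleE /= aus_rhoK.
Qed.

Lemma aus_faithful (phi : {linear aus_reg -> aus_reg}) :
  (forall (g : aus_dual) x, aus_app g (phi x) = 0) -> forall x, phi x = 0.
Proof. by move=> h x; apply: endoP => t; exact: (h (aus_rho t) x). Qed.

Lemma aus_dual_iso : mod_iso T aus_dual.
Proof.
exists (mklin aus_rho_linear2), (fun g => aus_app g (1 : S)) => [t|g].
  exact: (scale1r (t : aus_mod)).
exact: aus_rhoK.
Qed.

Variable X : subcat R.
Hypothesis XT : subcat_eq X (add_cat T).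

Let XP M : X M <-> add_coord T M.
Proof. by rewrite XT add_catP. Qed.

Lemma mod_iso_sym (Q : pzRingType) (M N : lmodType Q) : mod_iso M N -> mod_iso N M.
Proof. by case=> f /linear_inv[g [fK gK]]; exists g, f. Qed.

(** The duality is applied with [U = T], whose dual is the regular module of [S]. *)
Lemma chain_regular_addT n :
  cochain_regular (@proj_cat S) n -> chain_regular X n.
Proof.
apply: (chain_regular_dual endo_full endo_faithful).
- exact/XP/add_coord_self.
- by move=> M /XP.
- move=> P; rewrite proj_catP; split; apply: add_coord_iso.
    exact: endo_dual_iso.
  exact/mod_iso_sym/endo_dual_iso.
Qed.

(** The roles are exchanged: [U] is the regular module of [S], whose dual is [T]. *)
Lemma chain_regular_projS n :
  cochain_regular X n -> chain_regular (@proj_cat S) n.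
Proof.
apply: (chain_regular_dual aus_full aus_faithful).
- exact/proj_catP/add_coord_self.
- by move=> M /proj_catP.
- move=> P; rewrite XP; split; apply: add_coord_iso.
    exact: aus_dual_iso.
  exact/mod_iso_sym/aus_dual_iso.
Qed.

End Auslander.

Lemma proj_has_approx (R : pzRingType) : has_approx (@proj_cat R).
Proof.
move=> K /fin_gen_free[n [p ps]]; exists (free_mod R n), p; split=> //.
  exact: proj_cat_free.
by move=> M f [_ Mp]; exact: Mp.
Qed.

(** * Comparison of dimensions over [R] and over the Auslander algebra *)

Section GlobalDimension.
Variables (R : pzRingType) (T : lmodType R) (X : subcat R).
Local Notation S := ((auslander_algebra T)^c).
Hypotheses (RN : noeth R) (SN : noeth S) (hX : resolving X).
Hypotheses (Xapp : has_approx X) (XT : subcat_eq X (add_cat T)).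

Lemma resdim_le_gldim n :
  enat_le (resdim_mod (@proj_cat S)) (Some n) -> enat_le (resdim_mod X) (Some n).
Proof.
move=> /(resdim_mod_leP _ SN (@proj_cat_resolving _)) h.
apply/(resdim_mod_leP _ RN hX)/(chain_regular_rdim RN hX Xapp).
apply: (chain_regular_addT XT).
apply: (cochain_regular_rdim SN (@proj_cat_resolving _) (@proj_has_approx _)) => //.
by right=> M [].
Qed.

Lemma gldim_le_resdim n : (1 < n)%N \/ subcat_eq X (@proj_cat R) ->
  enat_le (resdim_mod X) (Some n) -> enat_le (resdim_mod (@proj_cat S)) (Some n).
Proof.
move=> n2 /(resdim_mod_leP _ RN hX) h.
apply/(resdim_mod_leP _ SN (@proj_cat_resolving _)).
apply: (chain_regular_rdim SN (@proj_cat_resolving _) (@proj_has_approx _)).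
apply: (chain_regular_projS XT); apply: cochain_regular_rdim => //.
by case: n2 => [|Xp]; [left | right=> M /Xp[]].
Qed.

(** The bound makes cochains of projectives over [S] regular in degree 1; by duality so are chains
    in [X], and free covers of objects of [X] split. *)
Lemma gldim_le1 :
  enat_le (resdim_mod (@proj_cat S)) (Some 1%N) -> subcat_eq X (@proj_cat R).
Proof.
move=> /(resdim_mod_leP _ SN (@proj_cat_resolving _)) h M.
split=> [XM|]; last exact: (resolving_proj hX).
split; first exact: (resolving_fin_gen hX XM).
apply: (chain_regular1_projective RN hX Xapp _ XM).
apply: (chain_regular_addT XT).
apply: (cochain_regular_rdim SN (@proj_cat_resolving _) (@proj_has_approx _)) => //.
by right=> N [].
Qed.

End GlobalDimension.

(** * Noetherian and Artinian rings *)

(** Dependent choice; it produces an infinite strict chain when no maximal or minimal submodule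
    exists. *)
Lemma dependent_sequence (E : Type) (P : E -> Prop) (lt : E -> E -> Prop) x0 :
  P x0 -> (forall x, P x -> exists2 y, P y & lt x y) ->
  exists f : nat -> E, forall n, P (f n) /\ lt (f n) (f n.+1).
Proof.
move=> P0 h.
have [g gP] : exists g : E -> E, forall x, P x -> P (g x) /\ lt x (g x).
  have h' x : exists y, P x -> P y /\ lt x y.
    by have [/h[y Py xy]|nP] := pselect (P x); [exists y | exists x].
  by have [g gP] := choice h'; exists g.
have Pf n : P (iter n g x0) by elim: n => [|n IH] //=; case: (gP _ IH).
by exists (fun n => iter n g x0) => n; split=> //=; case: (gP _ (Pf n)).
Qed.

Section NoethMod.
Variable R : pzRingType.
Implicit Types K M N P Q : lmodType R.

Definition noeth_mod M : Prop :=
  forall N (i : {linear N -> M}), injective i -> fin_gen N.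

(** A submodule [N] of [M] is an extension of its image in [P] by a submodule of [K]. *)
Lemma noeth_mod_ext K M P (f : {linear K -> M}) (g : {linear M -> P}) :
  short_exact f g -> noeth_mod K -> noeth_mod P -> noeth_mod M.
Proof.
case=> fi fg _ Kn Pn N i ii.
have [h [hs hE]] := im_factor (g \o i).
have hk : short_exact (kerv h) h by exact: ker_short_exact.
apply: fin_gen_ext hk _ _.
  have [|u uE] := linear_lift fi (linearP (i \o kerv h)).
    by move=> z; apply/fg; rewrite /= -[g _]/((g \o i) (kerv h z)) -hE kervK linear0.
  apply: (Kn _ u) => x y uxy; apply: (@kerv_inj _ _ _ h); apply: ii.
  by have := congr1 f uxy; rewrite !uE.
by apply: (Pn _ (imv (g \o i))); exact: smval_inj.
Qed.

(** The preimage [V] in [M] of a submodule of [Q] is finitely generated and maps onto that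
    submodule. *)
Lemma noeth_mod_surj M Q (p : {linear M -> Q}) :
  surj p -> noeth_mod M -> noeth_mod Q.
Proof.
move=> ps Mn N i ii.
pose V : submod M := ker_submod (quotp (im_submod i) \o p).
have VP x : x \in V -> exists y, i y = p x.
  by move=> /ker_submodE /= /quotp_eq0 /im_submodE.
have [|q qE] := linear_lift ii (linearP (p \o smval V)).
  by move=> z; apply/VP/smvalP.
apply: (fin_gen_surj (f := q)); last exact: (Mn _ _ (@smval_inj _ _ V)).
move=> y; have [x xE] := ps (i y).
have [|z zE] := @smval_surj _ _ V x.
  by apply/ker_submodE/quotp_eq0/im_submodE; exists y.
by exists z; apply: ii; rewrite qE /= zE.
Qed.

Section FfunShift.
Variables (M : lmodType R) (n : nat).
Local Notation Mn m := ({ffun 'I_m -> M} : lmodType R).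

Fact ffun_shift_linear : linear (fun c : Mn n =>
  [ffun i => if unlift ord0 i is Some j then c j else 0] : Mn n.+1).
Proof.
move=> a c d; apply/ffunP => i; rewrite !ffunE.
by case: (unlift ord0 i) => [j|]; rewrite ?ffunE// scaler0 addr0.
Qed.
Definition ffun_shift : {linear Mn n -> Mn n.+1} := mklin ffun_shift_linear.

Lemma ffun_short_exact : short_exact ffun_shift (@ffun_proj R M n.+1 ord0).
Proof.
split=> [c d cd|c|x].
- apply/ffunP => i; have /ffunP/(_ (lift ord0 i)) := cd.
  by rewrite !ffunE liftK.
- split=> /= [c0|[d <-]]; last by rewrite ffunE unlift_none.
  exists [ffun i => c (lift ord0 i)]; apply/ffunP => i; rewrite ffunE.
  by case: unliftP => [j ->|->]; rewrite ?ffunE.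
- by exists [ffun=> x]; rewrite /= ffunE.
Qed.

End FfunShift.

Lemma ffun0_fin_gen M : fin_gen ({ffun 'I_0 -> M} : lmodType R).
Proof.
exists 0%N, (fun=> 0) => x; exists (fun=> 0).
by apply/ffunP => -[].
Qed.

Lemma fin_gen_ffun M n : fin_gen M -> fin_gen ({ffun 'I_n -> M} : lmodType R).
Proof.
move=> fM; elim: n => [|n IH]; first exact: ffun0_fin_gen.
exact: fin_gen_ext (ffun_short_exact M n) IH fM.
Qed.

Lemma noeth_mod_free n : noeth_mod (R^o : lmodType R) -> noeth_mod (free_mod R n).
Proof.
move=> Rn; elim: n => [|n IH].
  move=> N i ii; exists 0%N, (fun=> 0) => x; exists (fun=> 0).
  by apply: ii; apply/ffunP => -[].
exact: noeth_mod_ext (ffun_short_exact _ n) IH Rn.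
Qed.

Lemma noeth_regular : noeth_mod (R^o : lmodType R) -> noeth R.
Proof.
move=> Rn M N i ii /fin_gen_free[n [p ps]].
exact: (noeth_mod_surj ps (noeth_mod_free Rn)) ii.
Qed.

(** Otherwise there is a strictly ascending sequence, whose union [V] is finitely generated. *)
Lemma noeth_maximal M (P : submod M -> Prop) U0 :
  noeth R -> fin_gen M -> P U0 ->
  exists2 U, P U & forall V, P V -> {subset U <= V} -> {subset V <= U}.
Proof.
move=> RN fM PU0; apply: contrapT => nmax.
have [U0' U0'P|f fP] := dependent_sequence (P := P)
    (lt := fun U V => {subset U <= V} /\ ~ {subset V <= U}) PU0.
  apply: contrapT => nV; apply: nmax; exists U0' => // V PV UV.
  by apply: contrapT => nVU; apply: nV; exists V.
have mono m n : (m <= n)%N -> {subset f m <= f n}.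
  move=> /subnK <-; elim: (n - m)%N => [|d IH] x xm //.
  by rewrite addSn; case: (fP (d + m)%N) => _ [s _]; apply/s/IH.
have [|||V VP] := @ex_submod _ M (fun x => exists n, x \in f n).
  - by exists 0%N; exact: rpred0.
  - move=> x y [m xm] [n yn]; exists (maxn m n); rewrite rpredD//.
      exact: mono (leq_maxl _ _) _ xm.
    exact: mono (leq_maxr _ _) _ yn.
  - by move=> a x [n xn]; exists n; rewrite rpredZ.
have [m [s sE]] := RN _ _ _ (@smval_inj _ _ V) fM.
have [g gE] := choice (fun i => proj1 (VP _) (smvalP (s i))).
(* All generators of the union already lie in stage [N], so the chain cannot grow there. *)
pose N := \max_i g i.
have [_ [_ []]] := fP N => x xN.
have /VP/(@smval_surj _ _ V)[v vE] : exists n, x \in f n by exists N.+1.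
have [c cE] := sE v; rewrite -vE cE linear_sum rpred_sum// => i _.
rewrite linearZ_LR rpredZ//; apply: mono (gE i).
exact: (leq_bigmax i).
Qed.

End NoethMod.

(** * Commutative Artinian rings are Noetherian *)

Section Artinian.
Variable k : comNzRingType.
Hypothesis kA : artinian k.
Local Notation I := (submod (k^o : lmodType k)).

Lemma artinian_minimal (P : I -> Prop) U0 : P U0 ->
  exists2 U, P U & forall V, P V -> {subset V <= U} -> {subset U <= V}.
Proof.
move=> PU0; apply: contrapT => nmin.
have [U0' U0'P|f fP] := dependent_sequence (P := P)
    (lt := fun U V => {subset V <= U} /\ ~ {subset U <= V}) PU0.
  apply: contrapT => nV; apply: nmin; exists U0' => // V PV VU.
  by apply: contrapT => nUV; apply: nV; exists V.
have fd n : {subset f n.+1 <= f n} by case: (fP n) => _ [].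
have [N NE] := kA (fun n => sm_closed (f n)) fd.
by have [_ [_ []]] := fP N => x; rewrite -(NE N.+1 (leqnSn N)).
Qed.

(* Multiplication by [x] on a minimal ideal [W] that is not finitely generated
   is either zero or surjective; so the annihilator of [W] is a maximal ideal,
   and a maximal subspace of [W] avoiding a nonzero vector is a hyperplane. *)
Lemma artinian_noeth : noeth k.
Proof.
apply: noeth_regular; apply: contrapT => nn.
have [U0 nU0] : exists U : I, ~ fin_gen (smtype U).
  apply: contrapT => allfg; apply: nn => N i ii.
  have fU : fin_gen (imm i).
    by apply: contrapT => nf; apply: allfg; exists (im_submod i).
  have [j jE] := linear_lift ii (linearP (imv i)) (fun u => proj1 (im_submodE _ _) (smvalP u)).
  apply: (fin_gen_surj (f := j)) fU => y.
  have [|u uE] := @smval_surj _ _ (im_submod i) (i y).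
    by apply/im_submodE; exists y.
  by exists u; apply: ii; rewrite jE.
have [W nW Wmin] := artinian_minimal (P := fun U : I => ~ fin_gen (smtype U)) nU0.
have Wfg (V : I) : {subset V <= W} -> ~ {subset W <= V} -> fin_gen (smtype V).
  by move=> VW nWV; apply: contrapT => nV; exact/nWV/Wmin.
(* The image and the kernel of multiplication by [x] on [W] cannot both be proper: both would be
   finitely generated, and so would [W]. *)
have dich x : (forall w, w \in W -> x * w = 0) \/
              (forall w, w \in W -> exists2 w', w' \in W & x * w' = w).
  have ml : linear (fun w : smtype W => x * smval W w : k^o).
    move=> a u v; rewrite linearP mulrDr; congr (_ + _).
    by rewrite -[a *: _]/(a * _) mulrCA.
  set m : {linear smtype W -> k^o} := mklin ml.
  have mW : {subset im_submod m <= W}.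
    by move=> _ /im_submodE[w <-]; exact: (rpredZ x (smvalP w)).
  have [Wm|/(Wfg _ mW) fm] := pselect {subset W <= im_submod m}.
    right=> w /Wm /im_submodE[w' w'E].
    by exists (smval W w') => //; exact: smvalP.
  pose kx : I := im_submod (smval W \o kerv m).
  have kW : {subset kx <= W}.
    by move=> _ /im_submodE[w <-]; exact: smvalP.
  have [Wk|/(Wfg _ kW) fk] := pselect {subset W <= kx}.
    left=> w /Wk /im_submodE[z <-]; exact: (kervK z).
  case: nW.
  have [g [gs gE]] := im_factor m.
  have gk : short_exact (kerv m) g.
    split=> [|z|//]; first exact: kerv_inj.
    split=> [gz|[z' <-]]; first by apply: kerv_surj; rewrite -gE gz linear0.
    by apply: (@smval_inj _ _ (im_submod m)); rewrite gE kervK linear0.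
  apply: fin_gen_ext gk _ fm.
  have [h [hs hE]] := im_factor (smval W \o kerv m).
  have hb : bijective h.
    apply: linear_bij hs => u v huv; apply: (@kerv_inj _ _ _ m).
    apply: (@smval_inj _ _ W); rewrite -[LHS]hE huv.
    exact: hE.
  have [h' [_ h'K]] := linear_inv hb.
  apply: (fin_gen_surj (f := h')) fk => z; exists (h z).
  by have /bij_inj := hb; apply; rewrite h'K.
(* If [x W = W], the ideals generated by the powers of [x] stabilise, giving
   [x ^+ N.+1 * y = x ^+ N]. Since also [x ^+ N] maps [W] onto [W], the product [x * y] acts as the
   identity on [W]. *)
have inv x : ~ (forall w, w \in W -> x * w = 0) ->
    exists y, forall w, w \in W -> x * y * w = w.
  case: (dich x) => // xW _.
  have xnW n w : w \in W -> exists2 w', w' \in W & x ^+ n * w' = w.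
    elim: n w => [|n IH] w wW; first by exists w; rewrite ?mul1r.
    have [w1 w1W <-] := IH _ wW; have [w2 w2W <-] := xW _ w1W.
    by exists w2; rewrite // exprSr mulrA.
  have hQ n : exists U : I, forall z, z \in U <-> exists t, x ^+ n * t = z.
    apply: ex_submod.
    - by exists 0; rewrite mulr0.
    - by move=> _ _ [s <-] [t <-]; exists (s + t); rewrite mulrDr.
    - by move=> a _ [s <-]; exists (a * s); rewrite mulrCA.
  have [Q QP] := choice hQ.
  have Qd n : {subset Q n.+1 <= Q n}.
    by move=> _ /QP[t <-]; apply/QP; exists (x * t); rewrite exprSr mulrA.
  have [N NE] := kA (fun n => sm_closed (Q n)) Qd.
  have /QP[y yE] : x ^+ N \in Q N.+1.
    by have -> := NE N.+1 (leqnSn N) (x ^+ N); apply/QP; exists 1; rewrite mulr1.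
  exists y => w /(xnW N)[w' _ <-].
  by rewrite -[in RHS]yE exprSr mulrCA !mulrA.
have [v vW v0] : exists2 v, v \in W & v != 0.
  apply: contrapT => W0; apply: nW; exists 0%N, (fun=> 0) => w.
  exists (fun=> 0); rewrite big_ord0; apply: (@smval_inj _ _ W).
  rewrite linear0; apply: contrapT => /eqP w0.
  by apply: W0; exists (smval W w) => //; exact: smvalP.
(* [P] does not ask for 0 in [A], so that the union of the empty chain qualifies; a maximal [A]
   contains 0 because adjoining it preserves [P]. *)
pose P (A : set k) := [/\ forall x, A x -> x \in W, ~ A v,
  forall x y, A x -> A y -> A (x + y) & forall a x, A x -> A (a * x)].
have [|A [[AW Av AD AM] Amax]] := Zorn_bigcup (P := P).
  move=> F FP tot; split.
  - by move=> x [B FB Bx]; case: (FP _ FB) => + _ _ _; apply.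
  - by move=> [B FB Bv]; case: (FP _ FB).
  - move=> x y [B FB Bx] [B' FB' B'y].
    have [BB|BB] := tot _ _ FB FB'.
      by exists B' => //; case: (FP _ FB') => _ _ + _; apply => //; exact: BB.
    by exists B => //; case: (FP _ FB) => _ _ + _; apply => //; exact: BB.
  - by move=> a x [B FB Bx]; exists B => //; case: (FP _ FB) => _ _ _; apply.
have A0 : A 0.
  apply: contrapT => nA0.
  have /Amax[] : (A `<` [set x | A x \/ x = 0])%classic.
    split=> [x Ax|]; first by left.
    by move=> /(_ 0) h; apply/nA0/h; right.
  split.
  - by move=> x [/AW//|->]; exact: rpred0.
  - by case=> // /eqP; rewrite (negbTE v0).
  - move=> x y [Ax|->] [Ay|->]; rewrite ?addr0 ?add0r; [left|left|left|right] => //.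
    exact: AD.
  - by move=> a x [Ax|->]; [left; exact: AM | right; rewrite mulr0].
have [U UP] := ex_submod (M := k^o) A0 AD AM.
have fU : fin_gen (smtype U).
  apply: Wfg; first by move=> x /UP/AW.
  by move=> /(_ v vW) /UP.
have fl : linear (fun z : smtype U * k^o => smval U z.1 + z.2 * v : k^o).
  move=> a x y; rewrite /= linearP mulrDl -mulrA scalerDr.
  by rewrite addrACA.
set f : {linear (smtype U * k^o)%type -> k^o} := mklin fl.
have [|g gE] := linear_lift (@smval_inj _ _ W) (linearP f).
  move=> [u c]; apply: smval_surj => /=.
  rewrite rpredD//; first exact/AW/UP/smvalP.
  exact: (rpredZ c vW).
apply: nW; apply: (fin_gen_surj (f := g)).
  move=> w; suff [z zE] : exists z, f z = smval W w.
    by exists z; apply: (@smval_inj _ _ W); rewrite gE.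
  have [Aw|nAw] := pselect (A (smval W w)).
    have /UP/(@smval_surj _ _ U)[u uE] := Aw.
    by exists (u, 0); rewrite /= uE mul0r addr0.
  move: (smvalP w) nAw; move: (smval W w) => {}w wW nAw.
  (* By maximality, adjoining [w] to [A] reaches [v = u + c * w]. Here [c] does not annihilate [W],
     since [v] is outside [A]; inverting it on [W] gives [w = y * (v - u)]. *)
  have [u Au [c vE]] : exists2 u, A u & exists c, v = u + c * w.
    apply: contrapT => nv.
    have /Amax[] : (A `<` [set x | exists2 u, A u & exists c, x = u + c * w])%classic.
      split=> [x Ax|]; first by exists x => //; exists 0; rewrite mul0r addr0.
      move=> /(_ w) h; apply/nAw/h; exists 0 => //; exists 1.
      by rewrite mul1r add0r.
    split=> //.
    - move=> _ [u Au [c ->]].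
      exact: (rpredD (AW _ Au) (rpredZ c wW)).
    - move=> _ _ [u Au [c ->]] [u' Au' [c' ->]].
      by exists (u + u'); [exact: AD | exists (c + c'); rewrite mulrDl addrACA].
    - move=> a _ [u Au [c ->]].
      by exists (a * u); [exact: AM | exists (a * c); rewrite mulrDr mulrA].
  have [|y yE] := inv c.
    by move=> /(_ w wW) cw; apply: Av; rewrite vE cw addr0.
  have /UP/(@smval_surj _ _ U)[u' u'E] : A (- y * u) by exact: AM.
  exists (u', y); rewrite /= u'E vE mulrDr mulNr addrA addNr add0r.
  by rewrite mulrA [y * c]mulrC yE.
apply: fin_gen_ext (pair_short_exact _ _) fU _.
exists 1%N, (fun=> 1) => x; exists (fun=> x).
by rewrite big_ord1 -[RHS]/(x * 1) mulr1.
Qed.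

End Artinian.

(** * Algebras that are finitely generated over a Noetherian ring *)

Record central_scalars (k : comNzRingType) (R : pzRingType) (iota : k -> R) :
    Prop := CentralScalars {
  scal1 : iota 1 = 1;
  scalM : forall a b, iota (a * b) = iota a * iota b;
  scalD : forall a b, iota (a + b) = iota a + iota b;
  scalC : forall a x, iota a * x = x * iota a
}.

Section Scalars.
Variables (k : comNzRingType) (R : pzRingType) (iota : k -> R).
Hypothesis iotaP : central_scalars iota.
Implicit Types M N K T : lmodType R.

Definition restr (h : central_scalars iota) M : Type := M.
HB.instance Definition _ h M := GRing.Zmodule.on (restr h M).

Section Structure.
Variable M : lmodType R.
Local Notation D := (restr iotaP M).
Definition restr_scale (a : k) (x : D) : D := iota a *: (x : M).
Fact restr_scaleA a b x : restr_scale a (restr_scale b x) = restr_scale (a * b) x.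
Proof. by rewrite /restr_scale scalerA -(scalM iotaP). Qed.
Fact restr_scale1 : left_id 1 restr_scale.
Proof. by move=> x; rewrite /restr_scale (scal1 iotaP) scale1r. Qed.
Fact restr_scaleDr : right_distributive restr_scale +%R.
Proof. by move=> a x y; exact: scalerDr. Qed.
Fact restr_scaleDl x : {morph restr_scale^~ x : a b / a + b}.
Proof. by move=> a b; rewrite /restr_scale (scalD iotaP) -scalerDl. Qed.
HB.instance Definition _ := GRing.Zmodule_isLmodule.Build k D
  restr_scaleA restr_scale1 restr_scaleDr restr_scaleDl.
End Structure.

Local Notation D M := (restr iotaP M : lmodType k).

Lemma restr_scaleE M (a : k) (x : D M) : a *: x = iota a *: (x : M).
Proof. by []. Qed.

Fact restr_map_linear M N (f : {linear M -> N}) : linear (f : D M -> D N).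
Proof. by move=> a x y; rewrite !restr_scaleE -linearP. Qed.
Definition restr_map M N (f : {linear M -> N}) : {linear D M -> D N} :=
  mklin (restr_map_linear f).

Lemma restr_fin_gen_inv M : fin_gen (D M) -> fin_gen M.
Proof.
case=> n [s sE]; exists n, s => x; have [c cE] := sE x.
by exists (iota \o c).
Qed.

Fact restr_free_linear n :
  linear (fun c : {ffun 'I_n -> D (R^o)} => (c : free_mod R n) : D (free_mod R n)).
Proof. by []. Qed.

Hypothesis R_fin_gen : fin_gen (D (R^o)).

Lemma restr_fin_gen M : fin_gen M -> fin_gen (D M).
Proof.
case/fin_gen_free=> n [p ps].
apply: (fin_gen_surj (f := restr_map p)); first by move=> y; exact: ps.
apply: (fin_gen_surj (f := mklin (@restr_free_linear n))).
  by move=> c; exists c.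
exact: fin_gen_ffun.
Qed.

Hypothesis kN : noeth k.

Lemma noeth_scalars : noeth R.
Proof.
move=> M N i ii fM; apply: restr_fin_gen_inv.
by apply: (kN (i := restr_map i)); [exact: ii | exact: restr_fin_gen].
Qed.

Fact scal_act_linear M (a : k) : linear (fun x : M => iota a *: x).
Proof. by move=> b x y; rewrite scalerDr !scalerA (scalC iotaP). Qed.
Definition scal_act M (a : k) : {linear M -> M} := mklin (scal_act_linear a).

Fact scal_actP M : is_action (@scal_act M).
Proof.
split=> [t|a b t|a b t] /=.
- by rewrite (scal1 iotaP) scale1r.
- by rewrite (scalM iotaP) scalerA.
- by rewrite (scalD iotaP) scalerDl.
Qed.

(** Evaluation at generators of [T] embeds Hom(T, K) into a finite power of [K], which is Noetherian
    over [k]. *)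
Lemma hom_fin_gen T K : fin_gen T -> fin_gen K ->
  fin_gen (dual_mod (@scal_actP K) T : lmodType k).
Proof.
case=> n [s sE] fK.
have el : linear (fun f : dual_mod (@scal_actP K) T => [ffun i => f (s i)] :
    {ffun 'I_n -> D K}).
  by move=> a f g; apply/ffunP => i; rewrite !ffunE.
apply: (kN (i := mklin el)); last exact/fin_gen_ffun/restr_fin_gen.
move=> f g /ffunP fg; apply: linear_ext => x; have [c ->] := sE x.
rewrite !linear_sum; apply: eq_bigr => i _; rewrite !linearZ_LR.
by have := fg i; rewrite !ffunE => ->.
Qed.

Variables (T : lmodType R) (X : subcat R).
Hypotheses (hX : resolving X) (XT : subcat_eq X (add_cat T)).

Lemma resolving_T : X T.
Proof. exact/XT/add_catP/add_coord_self. Qed.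

(** Generators of Hom(T, K) over [k] assemble into [p : T^n -> K]. Every map from [T] to [K] is a
    [k]-combination of them and so factors through [p], and this extends to [add T]. *)
Lemma hom_approx : has_approx X.
Proof.
move=> K fK; have Tfg := resolving_fin_gen hX resolving_T.
have [n [g gE]] := hom_fin_gen Tfg fK.
pose Tn : lmodType R := {ffun 'I_n -> T}.
pose p : {linear Tn -> K} :=
  lin_sum (fun i => (g i : {linear T -> K}) \o @ffun_proj R T n i).
have lift M (f : {linear M -> K}) : X M ->
    exists h : {linear M -> Tn}, forall x, p (h x) = f x.
  move=> /XT/add_catP[m [s [r sr]]].
  have [c cE] := choice (fun j => gE (f \o s j : {linear T -> K})).
  exists (lin_sum (fun j =>
    lin_sum (fun i => @ffun_inj R T n i \o (scal_act T (c j i) \o r j)))) => x.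
  rewrite {2}(sr x) !linear_sum; apply: eq_bigr => j _.
  have -> : f (s j (r j x)) = (f \o s j) (r j x) by [].
  rewrite (congr1 (fun h : dual_mod (@scal_actP K) T => h (r j x)) (cE j)).
  rewrite dual_sumE linear_sum; apply: eq_bigr => i _.
  rewrite dual_scaleE /= (bigD1 i)//= big1 => [|i' i'i].
    by rewrite ffunE eqxx addr0 linearZ_LR.
  by rewrite ffunE eq_sym (negbTE i'i) linear0.
exists Tn, p; split=> //; first by apply/XT/add_catP/add_coordP; exists n, idfun, idfun.
(* Surjectivity: a free cover of [K] has its source in [X], so it factors through [p]. *)
have [m [q qs]] := fin_gen_free fK.
have [h hE] := lift _ q (resolving_proj hX (proj_cat_free R m)).
by move=> y; have [x <-] := qs y; exists (h x).
Qed.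

Definition endo_scal (a : k) : (auslander_algebra T)^c := scal_act T a.

Fact endo_scalP : central_scalars endo_scal.
Proof.
split=> [|a b|a b|a e]; apply: endoP => t.
- exact: (act1 (scal_actP T)).
- exact: (actM (scal_actP T)).
- exact: (actD (scal_actP T)).
- exact/esym/linearZ_LR.
Qed.

End Scalars.

Lemma endo_restr_fin_gen (k : comNzRingType) (R : pzRingType) (iota : k -> R)
    (iotaP : central_scalars iota) (T : lmodType R) :
  fin_gen (restr iotaP R^o : lmodType k) -> noeth k -> fin_gen T ->
  fin_gen (restr (endo_scalP iotaP T) ((auslander_algebra T)^c)^o : lmodType k).
Proof.
move=> Rfg kN Tfg.
have fl : linear (fun f : dual_mod (scal_actP iotaP T) T =>
   (f : (auslander_algebra T)^c) :
     restr (endo_scalP iotaP T) ((auslander_algebra T)^c)^o).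
  by move=> a f g; apply: endoP.
apply: (fin_gen_surj (f := mklin fl)); first by move=> e; exists e.
exact: hom_fin_gen.
Qed.

(** * Semisimple rings *)

Section Semisimple.
Variable R : pzRingType.
Implicit Types M N P Q S : lmodType R.

Lemma mod_iso_trans M N P : mod_iso M N -> mod_iso N P -> mod_iso M P.
Proof. by case=> f fb [g gb]; exists (g \o f); exact: bij_comp. Qed.

Lemma semisimple_mod_iso M N : mod_iso M N -> semisimple_mod N -> semisimple_mod M.
Proof.
move=> MN ssN; case: ssN MN => {}N.
  move=> N0 [f /bij_inj fi]; apply: semisimple_mod0 => x.
  by apply: fi; rewrite (N0 (f x)) linear0.
move=> S P Ss Ps NSP MN; apply: (semisimple_modD Ss Ps).
exact: mod_iso_trans NSP.
Qed.

Lemma semisimple_mod_pair M N :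
  semisimple_mod M -> semisimple_mod N -> semisimple_mod (M * N)%type.
Proof.
move=> ssM ssN; elim: {M}ssM => [M M0|M S P Ss _ IH [f /linear_inv[g [fK gK]]]].
  apply: semisimple_mod_iso ssN; exists (pair_snd M N).
  exists (fun y => (0, y)) => // -[x y] /=.
  by rewrite (M0 x).
apply: (semisimple_modD Ss IH).
have hl : linear (fun z : M * N => ((f z.1).1, ((f z.1).2, z.2))).
  by move=> a x y /=; rewrite linearP.
exists (mklin hl); exists (fun z => (g (z.1, z.2.1), z.2.2)).
  by move=> [x y] /=; rewrite -surjective_pairing fK.
by move=> [s [p y]] /=; rewrite gK.
Qed.

(** Induction along [M = S * N]: let [C] complement [V], the part of [U] inside [N], and let [B] be
    the projection of [U] to [S]. If [B] is zero, [S] together with [C] is a complement of [U]; if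
    [B] is all of [S], then [C] alone is one. *)
Lemma semisimple_mod_complement M (U : submod M) : semisimple_mod M ->
  exists C : submod M, (forall x, x \in U -> x \in C -> x = 0) /\
    forall x, exists u c, [/\ u \in U, c \in C & x = u + c].
Proof.
move=> ssM; elim: ssM U => {M} [M M0 U|M S N [Sn0 Ss] _ IH [f /linear_inv[g [fK gK]]] U].
  exists U; split=> // x; exists 0, 0.
  by split; rewrite ?rpred0// (M0 x) addr0.
have [|||V VP] := @ex_submod _ N (fun y => g (0, y) \in U).
- by rewrite linear0 rpred0.
- move=> x y gx gy; have -> : (0, x + y) = (0, x) + (0, y) :> S * N.
    by congr pair; rewrite /= addr0.
  by rewrite linearD rpredD.
- move=> a x gx; have -> : (0, a *: x) = a *: (0, x) :> S * N.
    by congr pair; rewrite /= scaler0.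
  by rewrite linearZ_LR rpredZ.
have [C [UC CE]] := IH V.
have [|||B BP] := @ex_submod _ S (fun s => exists y, g (s, y) \in U).
- by exists 0; rewrite linear0 rpred0.
- move=> s t [x gx] [y gy]; exists (x + y).
  have -> : (s + t, x + y) = (s, x) + (t, y) by [].
  by rewrite linearD rpredD.
- move=> a s [x gx]; exists (a *: x).
  have -> : (a *: s, a *: x) = a *: (s, x) by [].
  by rewrite linearZ_LR rpredZ.
have [B0|BT] := Ss B (sm_closed B).
  have [|||D DP] := @ex_submod _ M (fun x => (f x).2 \in C).
  - by rewrite linear0 rpred0.
  - by move=> x y fx fy; rewrite linearD rpredD.
  - by move=> a x fx; rewrite linearZ_LR rpredZ.
  have Uf x : x \in U -> (f x).1 = 0.
    by move=> xU; apply/B0/BP; exists (f x).2; rewrite -surjective_pairing fK.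
  exists D; split=> [x xU /DP fxC|x].
    rewrite -[x]fK [f x]surjective_pairing Uf// (UC (f x).2)// ?linear0//.
    by apply/VP; rewrite -(Uf _ xU) -surjective_pairing fK.
  have [v [c [/VP vV cC e]]] := CE (f x).2.
  exists (g (0, v)), (g ((f x).1, c)); split=> //; first by apply/DP; rewrite gK.
  rewrite -linearD -[LHS]fK; congr (g _); rewrite [LHS]surjective_pairing e.
  by congr pair; rewrite /= add0r.
have [|||D DP] := @ex_submod _ M (fun x => (f x).1 = 0 /\ (f x).2 \in C).
- by rewrite linear0 rpred0.
- by move=> x y [fx1 fx2] [fy1 fy2]; rewrite linearD rpredD//= fx1 fy1 addr0.
- by move=> a x [fx1 fx2]; rewrite linearZ_LR rpredZ//= fx1 scaler0.
exists D; split=> [x xU /DP[fx1 fx2]|x].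
  rewrite -[x]fK [f x]surjective_pairing fx1 (UC (f x).2)// ?linear0//.
  by apply/VP; rewrite -fx1 -surjective_pairing fK.
have /BP[y yU] := BT (f x).1.
have [v [c [/VP vV cC e]]] := CE ((f x).2 - y).
exists (g ((f x).1, y) + g (0, v)), (g (0, c)); split.
- by rewrite rpredD.
- by apply/DP; rewrite gK.
- rewrite -!linearD -[LHS]fK; congr (g _); rewrite [LHS]surjective_pairing.
  by congr pair; rewrite /= ?addr0// -addrA -e addrC subrK.
Qed.

Lemma semisimple_free n : semisimple_mod (R^o : lmodType R) ->
  semisimple_mod (free_mod R n).
Proof.
move=> ssR; elim: n => [|n IH].
  by apply: semisimple_mod0 => x; apply/ffunP => -[].
apply: semisimple_mod_iso (semisimple_mod_pair ssR IH).
have fl : linear (fun c : free_mod R n.+1 =>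
    (c ord0, [ffun i => c (lift ord0 i)]) : (R^o * free_mod R n)%type).
  move=> a c d; congr pair; first by rewrite !ffunE.
  by apply/ffunP => i; rewrite !ffunE.
exists (mklin fl); exists (fun z : R^o * free_mod R n =>
  [ffun i => if unlift ord0 i is Some j then z.2 j else z.1] : free_mod R n.+1).
  move=> c; apply/ffunP => i; rewrite ffunE.
  by case: unliftP => [j ->|->] //=; rewrite ffunE.
move=> [x d]; congr pair; first by rewrite ffunE unlift_none.
by apply/ffunP => i; rewrite !ffunE liftK.
Qed.

(** A complement of the kernel of a free cover is isomorphic to [M], so [M] is a retract of a free
    module. *)
Lemma semisimple_projective : semisimple_mod (R^o : lmodType R) ->
  forall M, fin_gen M -> projective M.
Proof.
move=> ssR M /fin_gen_free[n [p ps]].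
have [C [UC CE]] := semisimple_mod_complement (ker_submod p) (semisimple_free n ssR).
have pC : bijective (p \o smval C).
  apply: linear_bij => [|y].
    apply: linear_inj => x /ker_submodE px.
    by apply: (@smval_inj _ _ C); rewrite linear0; apply: UC => //; exact: smvalP.
  have [x <-] := ps y; have [u [c [/ker_submodE uU]]] := CE x.
  by move=> /(@smval_surj _ _ C)[c' <-] ->; exists c'; rewrite /= linearD uU add0r.
have [g [_ gK]] := linear_inv pC.
apply: (@projective_retract _ _ _ (smval C \o g) p) (@free_projective R n) => y.
exact: (gK y).
Qed.

Lemma simple_quotient M (V : submod M) :
  (exists x, x \notin V) ->
  (forall U : submod M, (exists x, x \notin U) -> {subset V <= U} -> {subset U <= V}) ->
  simple_mod (quot_mod V : lmodType R).
Proof.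
move=> [x0 x0V] Vmax; split=> [Q0|B hB].
  by move/negP: x0V; apply; apply/quotp_eq0; exact: Q0.
have [|||U UP] := @ex_submod _ M (fun x => quotp V x \in Submod hB).
- by rewrite linear0 rpred0.
- by move=> x y Bx By; rewrite linearD rpredD.
- by move=> a x Bx; rewrite linearZ_LR rpredZ.
have [nU|allU] := pselect (exists x, x \notin U).
  left=> q qB; have [x xE] := quotp_surj q; rewrite -xE.
  apply/quotp_eq0/(Vmax U nU); last by apply/UP; rewrite xE.
  by move=> y yV; apply/UP; rewrite (proj2 (quotp_eq0 V y) yV) rpred0.
right=> q; have [x <-] := quotp_surj q; apply/UP.
by apply: contrapT => /negP nU; apply: allU; exists x.
Qed.

(* A maximal semisimple submodule has a complement; a simple quotient of the
   complement would split off and enlarge it. *)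
Lemma projective_semisimple : noeth R -> (forall M, fin_gen M -> projective M) ->
  forall M, fin_gen M -> semisimple_mod M.
Proof.
move=> RN Rp M fM.
pose P (U : submod M) := exists N (i : {linear N -> M}),
  [/\ semisimple_mod N, injective i & forall x, x \in U <-> exists n, i n = x].
have [|U [N [i [ssN ii UP]]] Umax] := @noeth_maximal _ _ P
    (im_submod (\0 : {linear free_mod R 0 -> M})) RN fM.
  have t0 (z : free_mod R 0) : z = 0 by apply/ffunP => -[].
  exists (free_mod R 0), \0; split; first exact: semisimple_mod0.
    by move=> x y _; rewrite (t0 x) (t0 y).
  exact: im_submodE.
pose Q : lmodType R := quot_mod U.
have fQ : fin_gen Q := fin_gen_surj (@quotp_surj _ _ U) fM.
have [s sK] := projective_split (Rp _ fQ) (@quotp_surj _ _ U).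
have qi n : quotp U (i n) = 0 by apply/quotp_eq0/UP; exists n.
have [Q0|/existsNP[q0 q0n]] := pselect (trivial_mod Q).
  apply: (semisimple_mod_iso _ ssN).
  have [|g [gK gK']] := @linear_inv _ _ _ i.
    apply: linear_bij => // x; apply/UP/quotp_eq0; exact: Q0.
  by exists g; exists i.
have [|V nV Vmax] := @noeth_maximal _ _ (fun V : submod Q => exists x, x \notin V)
    (im_submod (\0 : {linear free_mod R 0 -> Q})) RN fQ.
  by exists q0; apply/negP => /im_submodE[z /= /esym].
pose S : lmodType R := quot_mod V.
have Ss : simple_mod S := simple_quotient nV Vmax.
have [t tK] := projective_split (Rp _ (fin_gen_surj (@quotp_surj _ _ V) fQ))
                                (@quotp_surj _ _ V).
(* [s] after [t] embeds the simple quotient [S] of [Q] into [M], so the image of [j] is a semisimple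
   submodule containing [U]; maximality of [U] would force [S] to vanish. *)
have jl : linear (fun z : S * N => s (t z.1) + i z.2).
  by move=> a x y /=; rewrite !linearP /= scalerDr addrACA.
set j : {linear (S * N)%type -> M} := mklin jl.
have qj z : quotp U (j z) = t z.1 by rewrite linearD sK qi addr0.
have Pj : P (im_submod j).
  exists (S * N)%type, j; split; last exact: im_submodE.
    by apply: (semisimple_modD Ss ssN); exists idfun; exists idfun.
  apply: linear_inj => -[x n] jxn.
  have x0 : x = 0.
    have := qj (x, n); rewrite jxn linear0 => tx.
    by rewrite -[LHS]tK -[t x]tx linear0.
  move: jxn; rewrite x0 /= !linear0 add0r => in0.
  by congr pair; apply: ii; rewrite in0 linear0.
have jU : {subset im_submod j <= U}.
  apply: Umax Pj _ => x /UP[n <-]; apply/im_submodE; exists (0, n).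
  by rewrite /= !linear0 add0r.
case: Ss => Sn0 _; case: Sn0 => x.
have /jU/quotp_eq0 : j (x, 0) \in im_submod j by apply/im_submodE; exists (x, 0).
by rewrite qj => tx; rewrite -[LHS]tK [t x]tx linear0.
Qed.

End Semisimple.

(** * Global dimension of the Auslander algebra *)

Lemma enat_ext (x y : enat) :
  (forall n, enat_le x (Some n) <-> enat_le y (Some n)) -> x = y.
Proof.
case: x y => [m|] [n|] h //.
- have [/(_ (leqnn m)) /= nm _] := h m; have [_ /(_ (leqnn n)) /= mn] := h n.
  by congr Some; apply/eqP; rewrite eqn_leq mn.
- by have [/(_ (leqnn m))] := h m.
- by have [_ /(_ (leqnn n))] := h n.
Qed.

Lemma enat_max_leP x y n :
  enat_le (enat_max x y) (Some n) <-> enat_le x (Some n) /\ enat_le y (Some n).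
Proof.
case: x y => [p|] [q|] /=; try by split=> // -[].
by rewrite geq_max; split=> /andP.
Qed.

(** Dimension 0 says that all finitely generated modules are projective; in one direction the
    regular module is then split into simples. *)
Lemma gldim0P (R : pzRingType) : noeth R^c ->
  gldim R = Some 0%N <-> semisimple_ring R.
Proof.
move=> RN.
have le0 (x : enat) : enat_le x (Some 0%N) <-> x = Some 0%N.
  by case: x => [[|n]|] //=; split.
rewrite -le0 -[gldim R]/(resdim_mod (@proj_cat R^c)).
rewrite (resdim_mod_leP _ RN (@proj_cat_resolving _)).
split=> [h|ss M fM]; last by split=> //; exact: semisimple_projective.
apply: projective_semisimple => // [M /h[]//|].
by exists 1%N, (fun=> 1) => x; exists (fun=> x); rewrite big_ord1 -[RHS]/(_ * _) mulr1.
Qed.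

(** * Artin algebras as finitely generated modules over their base ring *)

Section ArtinAlgebra.
Variables (k : comNzRingType) (L : algType k).
Hypothesis hL : artin_algebra L.

Definition artin_scal (a : k) : L^c := a%:A.

Fact artin_scalP : central_scalars artin_scal.
Proof.
split=> [|a b|a b|a x].
- exact: scale1r.
- by rewrite /artin_scal -[RHS]/((b%:A : L) * a%:A) mulr_algl scalerA mulrC.
- exact: scalerDl.
- by rewrite /artin_scal -[LHS]/((x : L) * a%:A) mulr_algr -[RHS]/(a%:A * (x : L)) mulr_algl.
Qed.

Lemma artin_restr_fin_gen : fin_gen (restr artin_scalP (L^c)^o : lmodType k).
Proof.
case: hL => _ fL.
have fl : linear (fun x : L => (x : restr artin_scalP (L^c)^o)).
  move=> a x y; rewrite restr_scaleE; congr (_ + _).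
  by rewrite -[RHS]/((x : L) * a%:A) mulr_algr.
by apply: (fin_gen_surj (f := mklin fl)) fL => x; exists x.
Qed.

End ArtinAlgebra.

Local Close Scope ring_scope.

Theorem proposition6p4 (k : comNzRingType) (L : algType k)
  (hL : artin_algebra L)
  (X : subcat L^c) (hX : resolving X) (hfin : fin_rep_type X)
  (* a representation generator of X, by which its Auslander algebra is
     defined up to Morita equivalence *)
  (T : rmodType L) (hT : subcat_eq X (add_cat T)) :
  let A := auslander_algebra T in
  let proj := @proj_cat L^c in
  (* (i) *)
  ((gldim A = Some 0 <-> semisimple_ring L) /\
   (semisimple_ring L -> subcat_eq X proj)) /\
  (* (ii) *)
  (gldim A = Some 1 <-> gldim L = Some 1 /\ subcat_eq X proj) /\
  (* (iii) *)
  (gldim A = Some 2 <->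
     (subcat_eq X proj /\ gldim L = Some 2) \/
     (~ subcat_eq X proj /\ enat_le (resdim_mod X) (Some 2))) /\
  (* (iv) *)
  (enat_le (Some 3) (resdim_mod X) -> gldim A = resdim_mod X) /\
  (* in any case *)
  (subcat_eq X proj -> gldim A = gldim L) /\
  (~ subcat_eq X proj -> gldim A = enat_max (Some 2) (resdim_mod X)).
Proof.
move=> A proj.
have kN : noeth k := artinian_noeth (proj1 hL).
have fL := artin_restr_fin_gen hL.
have LN : noeth L^c := noeth_scalars fL kN.
have XT := resolving_T hT.
(* Endomorphisms of the finitely generated module [T] form a finitely generated [k]-module. *)
have AN : noeth A^c.
  apply: (noeth_scalars _ kN (iotaP := endo_scalP (artin_scalP L) T)).
  exact: endo_restr_fin_gen (resolving_fin_gen hX XT).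
have Xapp : has_approx X := hom_approx fL kN hX hT.
have le_res n : enat_le (gldim A) (Some n) -> enat_le (resdim_mod X) (Some n).
  exact: resdim_le_gldim LN AN hX Xapp hT n.
have res_le n : (1 < n)%N \/ subcat_eq X proj ->
    enat_le (resdim_mod X) (Some n) -> enat_le (gldim A) (Some n).
  exact: gldim_le_resdim LN AN hX Xapp hT n.
have le1 : enat_le (gldim A) (Some 1%N) -> subcat_eq X proj.
  exact: gldim_le1 LN AN hX Xapp hT.
have resE : subcat_eq X proj -> resdim_mod X = gldim L.
  move=> Xp; rewrite /gldim; suff -> : X = proj by [].
  by apply/funext => M; apply/propext.
have dimE : subcat_eq X proj -> gldim A = gldim L.
  move=> Xp; rewrite -resE//; apply: enat_ext => n.
  by split; [exact: le_res | apply: res_le; right].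
have dimN : ~ subcat_eq X proj -> gldim A = enat_max (Some 2%N) (resdim_mod X).
  move=> nXp; apply: enat_ext => n; rewrite enat_max_leP; split.
    move=> An; split; last exact: le_res.
    (* A bound of at most 1 on [gldim A] would force [X = proj]; this is where the 2 in the maximum
       comes from. *)
    rewrite /= ltnNge; apply/negP => n1; apply/nXp/le1.
    by case: (gldim A) An => //= d /leq_trans; apply.
  by case=> n2; apply: res_le; left.
have ss_proj : semisimple_ring L -> subcat_eq X proj.
  move=> ss M; split=> [XM|]; last exact: (resolving_proj hX).
  have fM := resolving_fin_gen hX XM.
  by split=> //; exact: semisimple_projective.
have Xp_le1 n : (n <= 1)%N -> gldim A = Some n -> subcat_eq X proj.
  by move=> n1 An; apply: le1; rewrite An.
split; [split=> // | split; [|split; [|split=> //]]].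
- split=> [A0|ss]; last by rewrite (dimE (ss_proj ss)); apply/gldim0P.
  by apply/(gldim0P LN); rewrite -dimE//; exact: (Xp_le1 0%N).
- split=> [A1|[L1 Xp]]; last by rewrite dimE.
  have Xp := Xp_le1 1%N isT A1.
  by split=> //; rewrite -dimE.
- split=> [A2|[[Xp L2]|[nXp X2]]]; last 2 first.
  + by rewrite dimE.
  + rewrite dimN//; case: (resdim_mod X) X2 => //= d d2.
    by rewrite (maxn_idPl d2).
  have [Xp|nXp] := pselect (subcat_eq X proj); [left|right]; split=> //.
    by rewrite -dimE.
  by apply: le_res; rewrite A2.
- move=> X3; have [Xp|nXp] := pselect (subcat_eq X proj); first by rewrite resE// dimE.
  rewrite dimN//; case: (resdim_mod X) X3 => //= d d3.
  by rewrite (maxn_idPr (ltnW d3)).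
Qed.
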